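(* Let $0<p<1$ and let $x\in\mathbb{Z}_+$ be fixed. Let $h_t(x)$ be the height function of oriented digital boiling with parameter $p$ and corner initialization. Then for every $s\in\mathbb{R}$, as $t\to\infty$, $$\mathrm{Prob}\left(\frac{h_t(x)-p\,t}{(p(1-p)\,t)^{1/2}}<s\right)\longrightarrow F^{GUE}_{x+1}(s),$$ where $F^{GUE}_{n}$ is the distribution function of the largest eigenvalue in the Gaussian Unitary Ensemble of $n\times n$ Hermitian matrices, normalized as in the context.
   Context: Oriented digital boiling (ODB) with parameter $p$ and corner initialization: a random height function $h_t:\mathbb{Z}_+\to\mathbb{Z}_+\cup\{-\infty\}$, $t=0,1,2,\dots$ (where $\mathbb{Z}_+=\{0,1,2,\dots\}$), with $h_0(0)=0$, $h_0(x)=-\infty$ for $x\ge1$, the convention $h_t(-1)=-\infty$ (and $-\infty+1=-\infty$), evolving as follows. If $h_t(x-1)>h_t(x)$ then $h_{t+1}(x)=h_t(x-1)$. Otherwise, independently of all other sites and times, $h_{t+1}(x)=h_t(x)+1$ with probability $p$ and $h_{t+1}(x)=h_t(x)$ with probability $1-p$. Equivalently $h_{t}(x)=\max\{h_{t-1}(x-1),\,h_{t-1}(x)+\epsilon_{x,t}\}$ with $\epsilon_{x,t}$ i.i.d. Bernoulli($p$). Normalization of the GUE: $F_n^{GUE}(s)=\det(I-K_{H,n})$, the Fredholm determinant over $L^2((s/\sqrt2,\infty))$ of the Hermite kernel $K_{H,n}(x,y)=\sum_{k=0}^{n-1}\varphi_k(x)\varphi_k(y)$, with $\varphi_k(x)=e^{-x^2/2}H_k(x)/\sqrt{2^kk!\,\pi^{1/2}}$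 and $H_k$ the Hermite polynomials orthogonal with respect to $e^{-x^2}$. Equivalently, $F_n^{GUE}$ is the distribution function of the maximum of $n$ points with joint density proportional to $\prod_{i<j}(x_i-x_j)^2e^{-\frac12\sum_j x_j^2}$. *)

(* Defs.v *)
From HB Require Import structures.
From mathcomp Require Import all_boot all_order all_algebra.
From mathcomp Require Import all_classical all_reals all_analysis.

Set Implicit Arguments.
Unset Strict Implicit.
Unset Printing Implicit Defensive.

Import Order.TTheory GRing.Theory Num.Theory.
Import numFieldNormedType.Exports.

Local Open Scope classical_set_scope.
Local Open Scope ring_scope.

Definition mutually_independent d d' (T : measurableType d)
    (T' : measurableType d') (R : realType) (P : probability T R)
    (I : eqType) (X : I -> {RV P >-> T'}) : Prop :=
  forall (s : seq I) (B : I -> set T'),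
    uniq s -> (forall i, measurable (B i)) ->
    P (\big[setI/setT]_(i <- s) (X i @^-1` B i)) =
    (\prod_(i <- s) P (X i @^-1` B i))%E.

Definition iid_bernoulli d (T : measurableType d) (R : realType)
    (P : probability T R) (p : R) (I : eqType) (X : I -> {RV P >-> bool}) :
    Prop :=
  (forall i, distribution P (X i) =1 bernoulli_prob p) /\
  mutually_independent X.

(* Heights live in \bar R so that -oo and -oo + 1 = -oo are the library's; the
   recursion only produces natural numbers and -oo. The noise used at site x
   in the step from time t to t + 1 is e (x, t + 1). *)
Fixpoint odb_height (R : realType) (e : nat * nat -> bool) (t x : nat) :
    \bar R :=
  match t with
  | 0 => if x is 0 then 0%E else -oo%E
  | t'.+1 =>
      let left := if x is x'.+1 then odb_height R e t' x' else -oo%E in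
      let here := odb_height R e t' x in
      if (here < left)%E then left
      else (here + (if e (x, t'.+1) then 1 else 0))%E
  end.

(* Integral of f over D ^ k, as an iterated Lebesgue integral. *)
Fixpoint iter_integral (R : realType) (D : set R) (k : nat)
    (f : seq R -> R) : R :=
  match k with
  | 0 => f [::]
  | k'.+1 => \int[lebesgue_measure]_(y in D)
               iter_integral D k' (fun u => f (y :: u))
  end.

(* det(I - K) on L^2(D), as the Fredholm series
   sum_k (-1)^k / k! * int_{D^k} det (K (u_i, u_j)) du. *)
Definition fredholm_det (R : realType) (D : set R) (K : R -> R -> R) : R :=
  limn (series (fun k : nat =>
    (-1) ^+ k / k`!%:R *
    iter_integral D k
      (fun u => \det (\matrix_(i < k, j < k) K u`_i u`_j)))).

(* Orthogonal for exp(-x^2), with leading coefficient 2^k. *)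
Fixpoint hermite (R : realType) (k : nat) : {poly R} :=
  match k with
  | 0 => 1
  | k'.+1 => 2%:R *: ('X * hermite R k') - (hermite R k')^`()
  end.

Definition hermite_fun (R : realType) (k : nat) (x : R) : R :=
  expR (- (x ^+ 2 / 2)) * (hermite R k).[x] /
  Num.sqrt (2 ^+ k * k`!%:R * Num.sqrt (pi : R)).

Definition hermite_kernel (R : realType) (n : nat) (x y : R) : R :=
  \sum_(k < n) hermite_fun k x * hermite_fun k y.

Definition F_GUE (R : realType) (n : nat) (s : R) : R :=
  fredholm_det `]s / Num.sqrt 2, +oo[ (hermite_kernel n).

(* Main.v *)
Require Import Defs.
From HB Require Import structures.
From mathcomp Require Import all_boot all_order all_fingroup all_algebra.
From mathcomp Require Import all_classical all_reals all_analysis.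
From mathcomp Require Import measurable_realfun.
From mathcomp Require Import ring lra zify.

(** Write [n = x + 1]. In the characteristic coordinates [lpp e t k], the height of
    site [k] at time [t + k], the process starts flat and is nondecreasing in [k], so
    that the event [lpp e t x < M] is [lpp e t k < M] for all [k <= x]. For a
    nondecreasing threshold vector [M] the probability of [lpp e t k < M k] for all
    [k < n] is a Schuetz-type determinant: both sides evolve by independent Bernoulli
    steps in each coordinate and satisfy the same boundary condition on the walls
    [M k = M k.+1 + 1]. For constant [M] row and column operations turn that
    determinant into a constant multiple of the Hankel determinant of the binomial
    law with [t + x] trials truncated below [M + x]; the constant is found by letting
    [M] be large. Rescaled truncated binomial moments converge to truncated Gaussian
    moments: quotients of consecutive binomial weights give the pointwise limit and a
    Gaussian domination, and dominated convergence applies to the associated step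
    functions. Finally the Fredholm series of a finite rank kernel is the determinant
    [det (1 - G)] of its Gram matrix [G], and the orthonormality of the Hermite functions
    identifies it with the quotient of the limiting Hankel determinants. *)

Set Implicit Arguments.
Unset Strict Implicit.
Unset Printing Implicit Defensive.

Import Order.TTheory GRing.Theory Num.Theory.
Import numFieldNormedType.Exports.

Local Open Scope classical_set_scope.
Local Open Scope ring_scope.

(** * Determinants of iterated partial sums *)

Section IterSum.
Variable R : comNzRingType.
Implicit Types (f g : {poly R}) (k M : nat).

(* The argument is shifted by one: 0 plays the role of -1, where all the iterated
   sums vanish, and M.+1 stands for the coefficient index M. *)
Fixpoint itersum f k M : R :=
  match k with
  | 0 => if M is M'.+1 then f`_M' else 0
  | k'.+1 => \sum_(l < M) itersum f k' l.+1
  end.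

Lemma itersum0 f k : itersum f k 0 = 0.
Proof. by case: k => //= k; rewrite big_ord0. Qed.

Lemma itersumS f k M :
  itersum f k.+1 M.+1 = itersum f k.+1 M + itersum f k M.+1.
Proof. by rewrite /= big_ord_recr. Qed.

Lemma itersum_lin a b f g k M :
  itersum (a *: f + b *: g) k M = a * itersum f k M + b * itersum g k M.
Proof.
elim: k M => [|k IH] [|M] /=; rewrite ?big_ord0 ?mulr0 ?addr0 //.
  by rewrite !coefE.
rewrite !mulr_sumr -big_split /=; apply: eq_bigr => i _; exact: IH.
Qed.

Lemma itersum_mulX f k M : itersum ('X * f) k M = itersum f k M.-1.
Proof.
elim: k M => [|k IH] [|M] //=.
- by rewrite coefXM; case: M.
- by rewrite !big_ord0.
rewrite big_ord_recl /= IH itersum0 add0r; apply: eq_bigr => i _.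
by rewrite IH.
Qed.

Lemma itersum_mulXn f d k M : itersum ('X^d * f) k (M + d) = itersum f k M.
Proof.
elim: d M => [|d IH] M; first by rewrite expr0 mul1r addn0.
by rewrite exprS -mulrA itersum_mulX addnS /= IH.
Qed.

Lemma itersum_affine p q f k M :
  itersum ((q%:P + p *: 'X) * f) k M = q * itersum f k M + p * itersum f k M.-1.
Proof.
rewrite mulrDl mul_polyC -scalerAl itersum_lin; congr (_ + _ * _).
exact: itersum_mulX.
Qed.

(** A factor [1 - 'X] replaces the coefficients by their differences, which undoes one summation. *)
Lemma itersum_1subX f k M : itersum ((1 - 'X) * f) k.+1 M = itersum f k M.
Proof.
have -> : 1 - 'X = 1%:P + (-1) *: 'X :> {poly R} by rewrite scaleN1r.
rewrite itersum_affine; case: M => [|M]; first by rewrite !itersum0 !mulr0 addr0.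
by rewrite itersumS /=; ring.
Qed.

Lemma itersum_1subXn f d k M :
  itersum ((1 - 'X) ^+ d * f) (d + k) M = itersum f k M.
Proof.
elim: d k => [|d IH] k; first by rewrite expr0 mul1r.
by rewrite exprS -mulrA addSn itersum_1subX IH.
Qed.

(** The weights are the coefficients of the power series of [(1 - X)^-(k+1)]; the induction on [M]
    is Pascal's rule. [M.-1] undoes the index shift of [itersum]. *)
Lemma itersum_bin f k M :
  itersum f k.+1 M = \sum_(l < M) 'C(M.-1 - l + k, k)%:R * f`_l.
Proof.
elim: k M => [|k IHk] M.
  by apply: eq_bigr => i _; rewrite bin0 mul1r.
elim: M => [|M IHM]; first by rewrite /= !big_ord0.
rewrite itersumS IHM IHk [RHS]big_ord_recr [X in _ + X]big_ord_recr /=.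
rewrite addrA -big_split /= subnn !add0n !binn; congr (_ + _).
apply: eq_bigr => i _; rewrite -mulrDl -natrD; congr (_%:R * _).
have -> : (M - i + k.+1 = (M - i + k).+1)%N by lia.
by rewrite binS; congr (_ + _)%N; congr 'C(_, _); have := ltn_ord i; lia.
Qed.

End IterSum.

(** * Schuetz-type determinants: evolution, boundary and initial conditions *)

Section SchutzDet.
Variables (R : comNzRingType) (n : nat) (p q : R).

Definition schutz_poly t : {poly R} := (1 - 'X) ^+ n * (q%:P + p *: 'X) ^+ t.

(** In effect the sum of order [j + 1 - i] of [(q + p X)^t] up to the coefficient [m + i - 1], a
    negative order meaning differences. The factor [(1 - X)^n] of [schutz_poly] raises the order by
    [n], so that it is a natural number for every row [i < n]. *)
Definition schutz_row t m (i j : nat) : R :=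
  itersum (schutz_poly t) (n.+1 + j - i) (m + i).

Definition schutz_det t (M : nat -> nat) : R :=
  \det (\matrix_(i < n, j < n) schutz_row t (M i) i j).

Lemma schutz_rowS t m i j : (0 < m)%N ->
  schutz_row t.+1 m i j = q * schutz_row t m i j + p * schutz_row t m.-1 i j.
Proof.
move=> m0; rewrite /schutz_row /schutz_poly exprS mulrCA itersum_affine.
by congr (_ + _ * itersum _ _ _); lia.
Qed.

Lemma schutz_det_eq0 t M : (0 < n)%N -> M 0%N = 0%N -> schutz_det t M = 0.
Proof.
move=> n0 M0; rewrite /schutz_det (expand_det_row _ (Ordinal n0)).
by apply: big1 => j _; rewrite mxE /= M0 /schutz_row itersum0 mul0r.
Qed.

(** Raising the threshold of row [k] from [M k.+1] by one adds the sum of one order less, which is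
    row [k.+1]. By multilinearity the difference of the two sides has two equal rows. *)
Lemma schutz_det_boundary t M k : (k.+1 < n)%N -> M k = (M k.+1).+1 ->
  schutz_det t M = schutz_det t (fun i => if i == k then M k.+1 else M i).
Proof.
move=> kn Mk; pose k0 := Ordinal (ltnW kn); pose k1 := Ordinal kn.
pose B := \matrix_(i < n, j < n)
  schutz_row t (if val i == k then M k.+1 else M i) i j.
pose C := \matrix_(i < n, j < n)
  (if val i == k then schutz_row t (M k.+1) k.+1 j else schutz_row t (M i) i j).
rewrite /schutz_det -/B.
rewrite (@determinant_multilinear _ _ _ B C k0 1 1).
- rewrite !mul1r [X in _ + X](determinant_alternate (i1 := k0) (i2 := k1)).
  + by rewrite addr0.
  + by rewrite -val_eqE /= ltn_eqF.
  + by move=> j; rewrite !mxE /= eqxx gtn_eqF.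
- apply/rowP => j; rewrite !mxE /= eqxx !mul1r Mk /schutz_row.
  have -> : (n.+1 + j - k = (n.+1 + j - k.+1).+1)%N by lia.
  by rewrite addSn itersumS addnS.
- apply/matrixP => i j; rewrite !mxE.
  have : val (lift k0 i) != k by rewrite eq_sym neq_bump.
  by move: (lift _ _) => l /negPf ->.
- apply/matrixP => i j; rewrite !mxE.
  have : val (lift k0 i) != k by rewrite eq_sym neq_bump.
  by move: (lift _ _) => l /negPf ->.
Qed.

(** Interpolates between times [t.+1] and [t]: rows before [j0] have already been taken back to time
    [t] with the noise [e], so that one Bernoulli variable is handled per row. *)
Definition schutz_mix t j0 (M : nat -> nat) (e : nat -> bool) : R :=
  \det (\matrix_(i < n, j < n)
    (if (i < j0)%N then schutz_row t (M i - e i) i j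
     else schutz_row t.+1 (M i) i j)).

Lemma schutz_mix0 t M e : schutz_mix t 0 M e = schutz_det t.+1 M.
Proof. by []. Qed.

Lemma schutz_mixn t M e : schutz_mix t n M e = schutz_det t (fun i => M i - e i)%N.
Proof. by congr (\det _); apply/matrixP => i j; rewrite !mxE ltn_ord. Qed.

Lemma schutz_mixS t j0 M e e1 e0 : (j0 < n)%N -> (0 < M j0)%N ->
  (forall i, (i < j0)%N -> e1 i = e i) -> (forall i, (i < j0)%N -> e0 i = e i) ->
  e1 j0 = true -> e0 j0 = false ->
  schutz_mix t j0 M e = p * schutz_mix t j0.+1 M e1 + q * schutz_mix t j0.+1 M e0.
Proof.
move=> jn Mj He1 He0 e1j e0j; apply: (determinant_multilinear (i0 := Ordinal jn)).
- apply/rowP => j; rewrite !mxE /= ltnn leqnn e1j e0j subn0 subn1.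
  by rewrite schutz_rowS // addrC.
- apply/matrixP => i j; rewrite !mxE.
  have : val (lift (Ordinal jn) i) != j0 by rewrite eq_sym neq_bump.
  move: (lift _ _) => l /negPf lj; rewrite ltnS leq_eqVlt lj /=.
  by case: ifP => // /He1 ->.
- apply/matrixP => i j; rewrite !mxE.
  have : val (lift (Ordinal jn) i) != j0 by rewrite eq_sym neq_bump.
  move: (lift _ _) => l /negPf lj; rewrite ltnS leq_eqVlt lj /=.
  by case: ifP => // /He0 ->.
Qed.

(** The matrix is triangular: an entry in row [r] and column [c < r] is a coefficient of
    [(1 - X)^(r-c-1)] beyond its degree, and a diagonal entry is one partial sum of the polynomial
    1. *)
Lemma schutz_det_init M : (forall i, (i < n)%N -> (0 < M i)%N) ->
  schutz_det 0 M = 1.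
Proof.
move=> M0; rewrite /schutz_det -det_tr det_trig.
  rewrite big1 // => i _; rewrite !mxE /schutz_row /schutz_poly.
  have -> : (n.+1 + i - i = n + 1)%N by lia.
  rewrite itersum_1subXn expr0 /=.
  have := M0 _ (ltn_ord i); case: (M i) => // m _.
  by rewrite addSn big_ord_recl /= coefC big1 ?addr0 // => l _; rewrite coefC.
apply/is_trig_mxP => i j ij; rewrite !mxE /schutz_row /schutz_poly expr0 mulr1.
have jn := ltn_ord j; have {}ij : (i < j)%N := ij.
have En : n = (n.+1 + i - j + (j - i.+1))%N by lia.
rewrite [X in _ ^+ X]En exprD -[X in itersum _ X _]addn0 itersum_1subXn /=.
have := M0 _ jn; case: (M j) => // m _; rewrite addSn.
pose u : {poly R} := 1 - 'X.
have su : (size u <= 2)%N.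
  by rewrite (leq_trans (size_polyD _ _)) // size_polyN size_polyX size_poly1.
rewrite -/u nth_default //; apply: (leq_trans (size_poly_exp_leq _ _)).
by nia.
Qed.

End SchutzDet.

(** * Reduction to binomial Hankel determinants *)

Section PolySize.
Variable R : nzRingType.
Implicit Types f g : {poly R}.

Lemma size_mul_bound f g a b c : (size f <= a)%N -> (size g <= b)%N ->
  (a + b <= c.+1)%N -> (size (f * g)%R <= c)%N.
Proof.
move=> fa gb abc; apply: (leq_trans (size_polyMleq _ _)).
rewrite -subn1 leq_subLR add1n; exact: leq_trans (leq_add fa gb) abc.
Qed.

Lemma size_linear (a b : R) : (size (a%:P + b *: 'X)%R <= 2)%N.
Proof.
rewrite (leq_trans (size_polyD _ _)) // geq_max.
rewrite (leq_trans (size_polyC_leq1 _)) //=.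
by rewrite (leq_trans (size_scale_leq _ _)) // size_polyX.
Qed.

Lemma size_linear_exp (a b : R) k : (size ((a%:P + b *: 'X) ^+ k)%R <= k.+1)%N.
Proof.
elim: k => [|k IH]; first by rewrite expr0 size_poly1.
by rewrite exprS; apply: (size_mul_bound (size_linear _ _) IH).
Qed.

Lemma size_1subX_exp k : (size ((1 - 'X : {poly R}) ^+ k)%R <= k.+1)%N.
Proof. by have := size_linear_exp 1 (-1) k; rewrite scaleN1r. Qed.

End PolySize.

Section Hankel.
Variables (R : numFieldType) (p q : R).
Hypotheses (p0 : p != 0) (q0 : q != 0).

Definition binomial_weight T l : R := 'C(T, l)%:R * p ^+ l * q ^+ (T - l).

Lemma binomial_weight_coef T l :
  ((q%:P + p *: 'X) ^+ T)`_l = binomial_weight T l.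
Proof.
rewrite exprDn coef_sum (eq_bigr (fun i : 'I_T.+1 =>
  if i == l :> nat then 'C(T, l)%:R * p ^+ l * q ^+ (T - l) else 0)); last first.
  move=> i _; rewrite coefMn exprZn -polyC_exp mul_polyC scalerA coefZ coefXn.
  rewrite eq_sym; case: eqP => [->|_]; last by rewrite mulr0 mul0rn.
  by rewrite mulr1 -mulr_natl; ring.
rewrite /binomial_weight; case: (ltnP l T.+1) => lT.
  by rewrite (bigD1 (Ordinal lT)) //= eqxx big1 ?addr0 // => i /negPf; rewrite -val_eqE /= => ->.
by rewrite bin_small // !mul0r big1 // => i _; case: eqP.
Qed.

Definition ffact_poly (a b : R) k : {poly R} :=
  \prod_(i < k) ((a - i%:R)%:P + b *: 'X).

Lemma size_ffact_poly a b k : (size (ffact_poly a b k) <= k.+1)%N.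
Proof.
rewrite /ffact_poly; elim: k => [|k IH]; first by rewrite big_ord0 size_poly1.
rewrite big_ord_recr /=; apply: (size_mul_bound IH (size_linear _ _)).
by rewrite addn2.
Qed.

Lemma coef_ffact_poly a b k : (ffact_poly a b k)`_k = b ^+ k.
Proof.
elim: k => [|k IH]; first by rewrite /ffact_poly big_ord0 coef1.
rewrite /ffact_poly big_ord_recr /= -/(ffact_poly a b k) mulrDr coefD.
rewrite mulrC mul_polyC coefZ -scalerAr coefZ coefMX /= IH.
by rewrite nth_default ?size_ffact_poly // mulr0 add0r exprS.
Qed.

Lemma horner_ffact_poly a b k m (y : R) : a + b * y = m%:R ->
  (ffact_poly a b k).[y] = (m ^_ k)%:R.
Proof.
move=> E; rewrite /ffact_poly horner_prod.
under eq_bigr => i _ do rewrite hornerD hornerC hornerZ hornerX addrAC E.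
elim: k => [|k IH]; first by rewrite big_ord0.
rewrite big_ord_recr /= IH ffactnSr natrM; case: (leqP k m) => km.
  by rewrite natrB.
by rewrite ffact_small // mulr0n !mul0r.
Qed.

(** Multiplied by [(l - k)! (t - (l - k))!] both sides become [(t + x)!]; outside the range of the
    binomial coefficients both vanish. *)
Lemma bin_ffact_shift t x k l : (k <= x)%N -> (k <= l)%N ->
  ('C(t, l - k) * (t + x) ^_ x = 'C(t + x, l) * (l ^_ k * (t + x - l) ^_ (x - k)))%N.
Proof.
move=> kx kl; case: (leqP l (t + x)) => lT; last first.
  by rewrite !bin_small //; lia.
case: (leqP (l - k) t) => lkt; last first.
  by rewrite bin_small // (@ffact_small (t + x - l)) ?muln0 //; lia.
have f1 := bin_fact lkt; have f2 := bin_fact lT.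
have f3 := ffact_fact kl.
have f4 : ((t + x - l) ^_ (x - k) * (t - (l - k))`! = (t + x - l)`!)%N.
  have h : (x - k <= t + x - l)%N by lia.
  by rewrite -(ffact_fact h); congr (_ * _`!)%N; lia.
have f5 : ((t + x) ^_ x * t`! = (t + x)`!)%N.
  by rewrite -{2}(addnK x t) ffact_fact // leq_addl.
have P1 := fact_gt0 (l - k); have P2 := fact_gt0 (t - (l - k)).
apply/eqP; rewrite -(eqn_pmul2r P1) -(eqn_pmul2r P2); apply/eqP.
transitivity ((t + x)`!)%N; first by rewrite -f5 -f1; ring.
by rewrite -f2 -f3 -f4; ring.
Qed.

(** Trading the prefactor [a] for [x] more trials gives all rows of the determinant the same weight,
    up to a polynomial in [l]. *)
Lemma binomial_weight_shift t x (a : {poly R}) : (size a <= x.+1)%N ->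
  exists2 Q : {poly R}, (size Q <= x.+1)%N &
    forall l, (a * (q%:P + p *: 'X) ^+ t)`_l =
              binomial_weight (t + x) l * Q.[l%:R].
Proof.
move=> sa.
(* The quotient of the binomial weight of [l - k] in [t] trials by that of [l] in [t + x] trials, a
   polynomial in [l] by [bin_ffact_shift]. *)
pose Qk k : {poly R} := (((t + x) ^_ x)%:R * p ^+ k * q ^+ (x - k))^-1 *:
  (ffact_poly 0 1 k * ffact_poly (t + x)%:R (-1) (x - k)).
exists (\sum_(k < x.+1) a`_k *: Qk k).
  apply: (leq_trans (size_sum _ _ _)); apply/bigmax_leqP => k _.
  apply: (leq_trans (size_scale_leq _ _)); apply: (leq_trans (size_scale_leq _ _)).
  apply: (size_mul_bound (size_ffact_poly _ _ _) (size_ffact_poly _ _ _)).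
  by have := ltn_ord k; lia.
move=> l; rewrite -[a in LHS](coefK a) (poly_def) big_distrl coef_sum /=.
rewrite horner_sum mulr_sumr.
rewrite (big_ord_widen x.+1 (fun i => (a`_i *: 'X^i * (q%:P + p *: 'X) ^+ t)`_l)) //.
rewrite big_mkcond /=; apply: eq_bigr => k _.
transitivity (a`_k * ('X^k * (q%:P + p *: 'X) ^+ t)`_l).
  case: ifP => ka; first by rewrite -scalerAl coefZ.
  by rewrite nth_default ?mul0r // leqNgt ka.
rewrite hornerZ mulrCA; congr (_ * _); rewrite coefXnM /Qk hornerZ hornerM.
rewrite (@horner_ffact_poly _ _ _ l) ?add0r ?mul1r //.
case: ltnP => lk; first by rewrite (ffact_small lk) mulr0n mul0r !mulr0.
rewrite binomial_weight_coef /binomial_weight.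
case: (leqP l (t + x)) => lT; last first.
  rewrite !bin_small ?mulr0n ?mul0r //; last by have := ltn_ord k; lia.
rewrite (@horner_ffact_poly _ _ _ (t + x - l)); last by rewrite natrB // mulN1r.
have kx : (k <= x)%N by rewrite -ltnS.
have h := congr1 (fun m => m%:R : R) (bin_ffact_shift t kx lk).
have T0 : ((t + x) ^_ x)%:R != 0 :> R by rewrite pnatr_eq0 -lt0n ffact_gt0 leq_addl.
case: (leqP (l - k) t) => lkt; last first.
  rewrite (bin_small lkt) mul0n in h; move: h; rewrite !natrM => /esym h.
  rewrite (bin_small lkt) mulr0n !mul0r; transitivity (('C(t + x, l)%:R * ((l ^_ k)%:R *
     ((t + x - l) ^_ (x - k))%:R)) *
     (p ^+ l * q ^+ (t + x - l) * (((t + x) ^_ x)%:R * p ^+ k * q ^+ (x - k))^-1)).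
    by rewrite h mul0r.
  by rewrite -!mulrA; ring.
have -> : p ^+ l = p ^+ (l - k) * p ^+ k by rewrite -exprD subnK.
have E : q ^+ (t + x - l) * q ^+ k = q ^+ (t - (l - k)) * q ^+ x.
  by rewrite -!exprD; congr (_ ^+ _); lia.
have -> : q ^+ (t + x - l) = q ^+ (t - (l - k)) * q ^+ (x - k).
  by rewrite -exprD; congr (_ ^+ _); lia.
have -> : 'C(t, l - k)%:R = 'C(t + x, l)%:R * ((l ^_ k)%:R *
     ((t + x - l) ^_ (x - k))%:R) / ((t + x) ^_ x)%:R :> R.
  by apply: (mulIf T0); rewrite divfK // -!natrM.
by field; rewrite ?T0 ?expf_neq0.
Qed.

Definition hankel n (w v : nat -> R) N : 'M[R]_n :=
  \matrix_(i, j) \sum_(l < N) w l * v l ^+ (i + j).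

(** Expanding [P i] and [Q j] in monomials writes the matrix as coefficients of [P], times the
    Hankel matrix, times the transposed coefficients of [Q]. *)
Lemma hankel_basis n (w v : nat -> R) N (P Q : nat -> {poly R}) :
  (forall i, (i < n)%N -> (size (P i) <= n)%N) ->
  (forall i, (i < n)%N -> (size (Q i) <= n)%N) ->
  \det (\matrix_(i < n, j < n) \sum_(l < N) w l * (P i).[v l] * (Q j).[v l]) =
  \det (\matrix_(i < n, j < n) (P i)`_j) * \det (hankel n w v N) *
  \det (\matrix_(i < n, j < n) (Q i)`_j).
Proof.
move=> sP sQ; rewrite -[X in _ = _ * X]det_tr -!det_mulmx; congr (\det _).
apply/matrixP => i j; rewrite !mxE.
under [RHS]eq_bigr => b _.
  rewrite !mxE big_distrl /=.
  under eq_bigr => a _ do rewrite !mxE mulr_sumr big_distrl /=.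
  over.
under [RHS]eq_bigr => b _ do rewrite exchange_big /=.
rewrite exchange_big /=; apply: eq_bigr => l _.
rewrite (horner_coef_wide _ (sP _ (ltn_ord i))) (horner_coef_wide _ (sQ _ (ltn_ord j))).
rewrite mulr_sumr; apply: eq_bigr => b _.
rewrite mulr_sumr big_distrl /=; apply: eq_bigr => a _.
by rewrite exprD; ring.
Qed.

(* The constant c depends on t but not on M: the column polynomials P N j depend on N
   only below their leading coefficients, which alone enter the determinant. *)
Lemma schutz_det_hankel x t (a b : R) : b != 0 ->
  exists c, forall M,
    schutz_det x.+1 p q t (fun=> M) =
    c * \det (hankel x.+1 (binomial_weight (t + x))
                (fun l => (l%:R - a) / b) (M + x)).
Proof.
move=> b0; pose f := (q%:P + p *: 'X) ^+ t.
have /choice[Q sQ] : forall i : nat, exists Q : {poly R}, (i <= x)%N ->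
   (size Q <= x.+1)%N /\ forall l, ('X^(x - i) * (1 - 'X) ^+ i * f)`_l =
              binomial_weight (t + x) l * Q.[(l%:R - a) / b].
  move=> i; case: (leqP i x) => ix; last by exists 0.
  have sA : (size ('X^(x - i) * (1 - 'X) ^+ i : {poly R})%R <= x.+1)%N.
    apply: (size_mul_bound (leqnn _) (size_1subX_exp _ _)).
    by rewrite size_polyXn; lia.
  have [Q sQ EQ] := binomial_weight_shift t sA.
  exists (Q \Po (a%:P + b *: 'X)) => _; split.
    apply: (leq_trans (size_comp_poly_leq _ _)).
    rewrite ltnS -[leqRHS]muln1 leq_mul //; first by rewrite -subn1 leq_subLR add1n.
    by rewrite -subn1 leq_subLR; exact: size_linear.
  move=> l; rewrite EQ horner_comp; congr (_ * _.[_]).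
  by rewrite hornerD hornerZ hornerX hornerC; field.
(* At the node [y = (l - a) / b] this is the weight ['C(N.-1 - l + j, j)] of [itersum_bin], because
   [N - 1 + j - l = (N - 1 + j - a) - b y]. *)
pose P N j : {poly R} := (j`!%:R)^-1 *: ffact_poly ((N.-1 + j)%:R - a) (- b) j.
exists (\det (\matrix_(i < x.+1, j < x.+1) (Q i)`_j) *
        \prod_(i < x.+1) ((i`!%:R)^-1 * (- b) ^+ i)) => M.
have sP N i : (size (P N i) <= i.+1)%N.
  by apply: (leq_trans (size_scale_leq _ _)); exact: size_ffact_poly.
have -> : \prod_(i < x.+1) ((i`!%:R)^-1 * (- b) ^+ i) =
          \det (\matrix_(i < x.+1, j < x.+1) (P (M + x)%N i)`_j).
  rewrite det_trig.
    by apply: eq_bigr => i _; rewrite mxE coefZ coef_ffact_poly.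
  apply/is_trig_mxP => i j ij; rewrite mxE nth_default //.
  exact: leq_trans (sP _ _) ij.
rewrite mulrAC -hankel_basis.
- congr (\det _); apply/matrixP => i j; rewrite !mxE /schutz_row /schutz_poly.
  have ix : (i <= x)%N by rewrite -ltnS.
  (* All but [i] of the factors [1 - 'X] cancel against summations, leaving order [j.+1] in every
     row; multiplying by ['X^(x - i)] then brings the upper limit [M + i] to the common value
     [M + x]. *)
  have En : x.+1 = ((x.+1 - i) + i)%N by lia.
  have -> : (x.+2 + j - i = (x.+1 - i) + j.+1)%N by lia.
  rewrite [X in (1 - 'X) ^+ X]En exprD -mulrA itersum_1subXn.
  have -> : (M + x = M + i + (x - i))%N by lia.
  rewrite -(itersum_mulXn _ (x - i)) itersum_bin mulrA.
  have -> : (M + i + (x - i) = M + x)%N by lia.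
  have [_ EQ] := sQ _ ix.
  apply: eq_bigr => l _; rewrite EQ mulrC; congr (_ * _).
  rewrite /P hornerZ (@horner_ffact_poly _ _ _ ((M + x).-1 - l + j)).
    rewrite -bin_ffact natrM mulrC mulfK // pnatr_eq0 -lt0n; exact: fact_gt0.
  have lM : (l <= (M + x).-1)%N by have := ltn_ord l; lia.
  by rewrite !natrD natrB //; field.
- by move=> i ix; case: (sQ i).
- by move=> i ix; apply: leq_trans (sP _ _) ix.
Qed.

End Hankel.

(** * Events depending on finitely many Bernoulli variables *)

Section Bern.
Variables (R : realType) (p : R) (I : eqType).
Implicit Types (e : I -> bool) (s : seq I) (Q : (I -> bool) -> bool).

Definition upd e i b : I -> bool := fun j => if j == i then b else e j.

(** The probability of [Q] when the coordinates in [s] are independent Bernoulli and the others are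
    frozen at [e]. The recursion reveals one coordinate at a time, as the determinant does with its
    rows. *)
Fixpoint bern s Q e : R :=
  match s with
  | [::] => (Q e)%:R
  | i :: s' => p * bern s' Q (upd e i true) + (1 - p) * bern s' Q (upd e i false)
  end.

Lemma eq_bern s Q Q' e :
  (forall e', (forall i, i \notin s -> e' i = e i) -> Q e' = Q' e') ->
  bern s Q e = bern s Q' e.
Proof.
elim: s e => [|i s IH] e QQ' /=; first by rewrite QQ'.
by congr (_ * _ + _ * _); apply: IH => e' He'; apply: QQ' => j;
  rewrite inE negb_or => /andP[/negPf ji js]; rewrite He' // /upd ji.
Qed.

Lemma bern_const s c e : bern s (fun=> c) e = c%:R.
Proof. by elim: s e => //= i s IH e; rewrite !IH; ring. Qed.

End Bern.

Section ProbBern.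
Variables (R : realType) (d : measure_display) (T : measurableType d).
Variables (P : probability T R) (p : R) (I : choiceType) (X : I -> {RV P >-> bool}).
Hypotheses (p0 : 0 <= p) (p1 : p <= 1) (iidX : iid_bernoulli p X).

Implicit Types (Q : (I -> bool) -> bool).

Let wt (c : bool) : R := if c then p else 1 - p.

Lemma prob_preimage_bool i c : P (X i @^-1` [set c]) = (wt c)%:E.
Proof.
have := iidX.1 i [set c]; rewrite /distribution /pushforward => ->.
by rewrite /bernoulli_prob p0 p1 fsbig_set1.
Qed.

(** The form needed for induction on [s]: coordinates in [r] have already been revealed with values
    [b], and moving [i] from [s] to [r] splits the event into two disjoint ones. *)
Lemma prob_bern_cond s r b Q : uniq (s ++ r) ->
  (forall e e', {in s ++ r, e =1 e'} -> Q e = Q e') ->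
  let A := \big[setI/setT]_(i <- r) (X i @^-1` [set b i]) `&`
           [set w | Q (fun i => X i w)] in
  measurable A /\ P A = (\prod_(i <- r) wt (b i) * bern p s Q b)%:E.
Proof.
elim: s r b => [|i s IH] r b /= us Qs.
  have mC : measurable (\big[setI/setT]_(i <- r) (X i @^-1` [set b i])).
    apply: bigsetI_measurable => i _; rewrite -[X in measurable X]setTI.
    exact: measurable_funP.
  have E : \big[setI/setT]_(i <- r) (X i @^-1` [set b i]) `&`
      [set w | Q (fun i => X i w)] =
      if Q b then \big[setI/setT]_(i <- r) (X i @^-1` [set b i]) else set0.
    have Qb w : (\big[setI/setT]_(i <- r) (X i @^-1` [set b i])) w ->
        Q (fun i => X i w) = Q b.
      rewrite -(bigcap_seq r (fun i => X i @^-1` [set b i])) => Cw.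
      by apply: Qs => i ir; apply: Cw.
    case: ifP => Qbt; apply/seteqP; split => w //=.
    - by case.
    - by move=> Cw; split => //; rewrite Qb.
    - by case=> Cw; rewrite Qb // Qbt.
  rewrite E; case: (Q b); last by rewrite measure0 mulr0.
  split => //; rewrite (iidX.2 r (fun i => [set b i])) // mulr1 -prodEFin.
  by apply: eq_bigr => i _; exact: prob_preimage_bool.
case/andP: us => inr us.
pose A c := \big[setI/setT]_(j <- i :: r) (X j @^-1` [set upd b i c j]) `&`
   [set w | Q (fun i => X i w)].
have bE c : \big[setI/setT]_(j <- i :: r) (X j @^-1` [set upd b i c j]) =
    X i @^-1` [set c] `&` \big[setI/setT]_(j <- r) (X j @^-1` [set b j]).
  rewrite big_cons /upd eqxx; congr (_ `&` _); apply: eq_big_seq => j jr.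
  by case: eqP => // ji; move: inr; rewrite mem_cat -ji jr orbT.
have wE c : \prod_(j <- i :: r) wt (upd b i c j) = wt c * \prod_(j <- r) wt (b j).
  rewrite big_cons /upd eqxx; congr (_ * _); apply: eq_big_seq => j jr.
  by case: eqP => // ji; move: inr; rewrite mem_cat -ji jr orbT.
have IHA c : measurable (A c) /\
    P (A c) = (\prod_(j <- i :: r) wt (upd b i c j) * bern p s Q (upd b i c))%:E.
  apply: IH.
    by rewrite -cat1s uniq_catCA /= inr.
  move=> e e' ee'; apply: Qs => j jin; apply: ee'.
  by move: jin; rewrite !(inE, mem_cat) orbCA.
have -> : \big[setI/setT]_(j <- r) (X j @^-1` [set b j]) `&`
    [set w | Q (fun i => X i w)] = A true `|` A false.
  rewrite /A !bE; apply/seteqP; split => w /=.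
    by case=> Cw Qw; case Xw: (X i w); [left|right].
  by case=> -[[_ Cw] Qw].
split; first by apply: measurableU; [case: (IHA true)|case: (IHA false)].
transitivity (P (A true) + P (A false))%E; last first.
  rewrite (IHA true).2 (IHA false).2 !wE -EFinD /=; congr (_%:E).
  by rewrite /wt; ring.
apply: measureU; [by case: (IHA true)|by case: (IHA false)|].
rewrite /A !bE; apply/seteqP; split => w //=.
by case=> -[[-> _] _] [[]].
Qed.

Lemma prob_bern s Q : uniq s -> (forall e e', {in s, e =1 e'} -> Q e = Q e') ->
  P [set w | Q (fun i => X i w)] = (bern p s Q (fun=> false))%:E.
Proof.
move=> us Qs; have := @prob_bern_cond s [::] (fun=> false) Q.
rewrite cats0 big_nil setTI /= => /(_ us Qs)[_ ->].
by rewrite big_nil mul1r.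
Qed.

End ProbBern.

(** * The determinantal formula for the heights *)

(* lpp e t k is the height of site k at time t + k, before which it may be -oo. *)
Fixpoint lpp (e : nat * nat -> bool) (t : nat) : nat -> nat :=
  match t with
  | 0 => fun=> 0%N
  | t'.+1 => fix row k :=
      match k with
      | 0 => (lpp e t' 0 + e (0, t'.+1))%N
      | k'.+1 => maxn (row k') (lpp e t' k'.+1 + e (k'.+1, t'.+1 + k'.+1))%N
      end
  end.

Section Lpp.
Implicit Types (e : nat * nat -> bool) (M : nat -> nat).

Lemma lppSS e t k : lpp e t.+1 k.+1 =
  maxn (lpp e t.+1 k) (lpp e t k.+1 + e (k.+1, t.+1 + k.+1))%N.
Proof. by []. Qed.

Lemma lpp_mono e t k l : (k <= l)%N -> (lpp e t k <= lpp e t l)%N.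
Proof.
move=> /subnK <-; elim: (l - k)%N => //= m /leq_trans; apply; rewrite addSn.
by case: t => //= t; exact: leq_maxl.
Qed.

Lemma lpp_le e t k : (lpp e t k <= t)%N.
Proof.
elim: t k => //= t IH; elim=> [|k IHk].
  by have := IH 0%N; have := leq_b1 (e (0, t.+1)); lia.
by have := IH k.+1; have := leq_b1 (e (k.+1, (t + k.+1).+1)); lia.
Qed.

Lemma lpp_step e t k : (lpp e t k + e (k, t.+1 + k) <= lpp e t.+1 k)%N.
Proof. by case: k => [|k]; rewrite ?addn0 // lppSS leq_maxr. Qed.

Lemma odb_heightSS (R : realType) e t k : odb_height R e t.+1 k.+1 =
  (if (odb_height R e t k.+1 < odb_height R e t k)%E then odb_height R e t k
   else odb_height R e t k.+1 + (if e (k.+1, t.+1) then 1 else 0))%E.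
Proof. by []. Qed.

Lemma odb_height_oo (R : realType) e t k : (t < k)%N ->
  odb_height R e t k = -oo%E.
Proof.
elim: t k => [|t IH] [|k] //= tk.
by rewrite !IH ?ltxx //; lia.
Qed.

(** The case distinction in the dynamics is a maximum: heights are integers and the noise is at most
    1, so a strictly higher left neighbour is at least [here] plus the noise. *)
Lemma odb_height_lpp (R : realType) e t k :
  odb_height R e (t + k) k = (lpp e t k)%:R%:E.
Proof.
elim: t k => [|t IHt].
  case=> [|k]; rewrite ?add0n //.
  suff E : forall j, odb_height R e j j = 0%E by rewrite E.
  by elim=> //= j IH; rewrite IH odb_height_oo // ltNye.
elim=> [|k IHk].
  rewrite addn0 /=; have := IHt 0%N; rewrite addn0 => ->.
  by rewrite ltNge leNye /=; rewrite natrD; case: (e _); rewrite -EFinD.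
rewrite addnS odb_heightSS IHk addSnnS IHt lte_fin ltr_nat lppSS addSn.
move: (lpp_step e t k.+1); rewrite lppSS addSn /maxn.
case: (ltnP (lpp e t k.+1) (lpp e t.+1 k)) => h1 h2.
  by case: ltnP h2 => // h3 _; have := leq_b1 (e (k.+1, (t + k.+1).+1)); lia.
have -> : (if e (k.+1, (t + k.+1).+1) then 1 else 0)%E =
  (e (k.+1, (t + k.+1).+1))%:R%:E :> \bar R by case: (e _).
rewrite -EFinD -natrD; case: ltnP => // h3; congr (_%:R%:E).
by move: h3; lia.
Qed.

Definition lpp_lt n t M e : bool := [forall k : 'I_n, lpp e t k < M k]%N.

Lemma lpp_ltP n t M e :
  reflect (forall k, (k < n)%N -> (lpp e t k < M k)%N) (lpp_lt n t M e).
Proof.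
apply: (iffP forallP) => H k; last exact: H.
by move=> kn; exact: (H (Ordinal kn)).
Qed.

(** With nondecreasing thresholds, the bound on site [k] at time [t.+1] already controls the left
    neighbour in the maximum for site [k.+1]. What remains is one separate condition per site. *)
Lemma lpp_ltS n t M e :
  (forall k, (k.+1 < n)%N -> (M k <= M k.+1)%N) ->
  lpp_lt n t.+1 M e = lpp_lt n t (fun k => M k - e (k, t.+1 + k))%N e.
Proof.
move=> mM; apply/lpp_ltP/lpp_ltP => H k kn.
  by have := H _ kn; have := lpp_step e t k; lia.
elim: k kn => [|k IHk] kn.
  by have := H _ kn; rewrite /= addn0; lia.
rewrite lppSS gtn_max; apply/andP; split.
  exact: leq_trans (IHk (ltnW kn)) (mM _ kn).
by have := H _ kn; lia.
Qed.

(** The noise that takes [lpp] from [t] to [t.+1], for the sites from [j] on: what is still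
    unrevealed when [schutz_mix] has reached row [j]. *)
Definition layer n t j : seq (nat * nat) :=
  [seq (k, (t.+1 + k)%N) | k <- iota j (n - j)].

Fixpoint sites n t : seq (nat * nat) :=
  if t is t'.+1 then layer n t' 0 ++ sites n t' else [::].

Lemma mem_layer n t k s : ((k, s) \in layer n t 0) = (k < n)%N && (s == t.+1 + k)%N.
Proof.
rewrite /layer subn0; apply/mapP/andP => [[l]|[kn /eqP ->]].
  by rewrite mem_iota /= add0n => ln [-> ->].
by exists k => //; rewrite mem_iota.
Qed.

Lemma mem_sites n t k s :
  ((k, s) \in sites n t) = [&& (k < n)%N, (k < s)%N & (s <= t + k)%N].
Proof.
elim: t => [|t IH] /=; first by rewrite in_nil add0n; lia.
by rewrite mem_cat mem_layer IH; lia.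
Qed.

Lemma uniq_sites n t : uniq (sites n t).
Proof.
elim: t => //= t IH; rewrite cat_uniq IH andbT; apply/andP; split.
  by rewrite map_inj_uniq ?iota_uniq // => k l [].
apply/hasPn => -[k s]; rewrite mem_sites mem_layer; lia.
Qed.

Lemma lpp_sites n t k e e' : (k < n)%N -> {in sites n t, e =1 e'} ->
  lpp e t k = lpp e' t k.
Proof.
elim: t k => //= t IHt k + ee'.
have {}IHt j : (j < n)%N -> lpp e t j = lpp e' t j.
  by move=> jn; apply: IHt => // i it; apply: ee'; rewrite mem_cat it orbT.
elim: k => [|k IHk] kn /=.
  by rewrite IHt // ee' // mem_cat mem_layer kn addn0 eqxx.
by rewrite IHk ?IHt ?ee' //; [rewrite mem_cat mem_layer kn eqxx|exact: ltnW].
Qed.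

End Lpp.

(** * The law of the heights as a Schuetz-type determinant *)

Section Schutz.
Variables (R : realType) (p : R) (n : nat).
Hypothesis n0 : (0 < n)%N.
Implicit Types (e : nat * nat -> bool) (M : nat -> nat).

Let chamber M := forall k, (k.+1 < n)%N -> (M k <= M k.+1)%N.

(* One Bernoulli step leaves the chamber by at most one unit in each pair of
   coordinates; the boundary condition brings the thresholds back from right to left. *)
Lemma schutz_near_chamber t :
  (forall M e, chamber M ->
    bern p (sites n t) (lpp_lt n t M) e = schutz_det n p (1 - p) t M) ->
  forall j M e, (forall k l, (k < l < n)%N -> (M k <= (M l).+1)%N) ->
    (forall k, (j <= k)%N -> (k.+1 < n)%N -> (M k <= M k.+1)%N) ->
    bern p (sites n t) (lpp_lt n t M) e = schutz_det n p (1 - p) t M.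
Proof.
move=> IH; elim=> [|j IHj] M e nM cM; first by apply: IH => k kn; apply: cM.
case: (boolP ((j.+1 < n) && (M j == (M j.+1).+1))%N) => [/andP[jn /eqP Mj]|h].
  (* Lowering [M j] to [M j.+1] changes neither side: the determinant by the boundary condition, the
     event because [lpp] is nondecreasing in the site. *)
  rewrite (schutz_det_boundary _ _ _ jn Mj) -(IHj _ e).
  - apply: eq_bern => e' _; apply/lpp_ltP/lpp_ltP => H k kn.
      have := H _ kn; case: eqP => // -> _.
      exact: leq_ltn_trans (lpp_mono _ _ (leqnSn _)) (H _ jn).
    by have := H _ kn; case: eqP => // -> ?; rewrite Mj ltnS ltnW.
  - move=> k l /andP[kl ln]; case: (eqVneq k j) => [kj|kj].
      rewrite gtn_eqF -?kj //; case: (eqVneq l k.+1) => [->|lk] //.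
      by apply: nM; rewrite ln; lia.
    case: (eqVneq l j) => [lj|lj]; last by apply: nM; rewrite kl.
    by apply: nM; lia.
  - move=> k jk kn; case: (eqVneq k j) => [->|kj].
      by rewrite gtn_eqF.
    by rewrite gtn_eqF ?cM //; lia.
apply: IHj => // k jk kn; case: (eqVneq k j) => [kj|kj]; last by apply: cM => //; lia.
have := nM k k.+1; rewrite ltnSn kn => /(_ isT).
by move: h; rewrite -kj kn /=; lia.
Qed.

(** Induction on [t]. If [M 0] is 0 both sides vanish; otherwise revealing the noise of a layer site
    by site matches the expansion of the determinant row by row in [schutz_mixS]. *)
Lemma bern_lpp t M e : chamber M ->
  bern p (sites n t) (lpp_lt n t M) e = schutz_det n p (1 - p) t M.
Proof.
elim: t M e => [|t IH] M e cM.
  have M0M k : (k < n)%N -> (M 0%N <= M k)%N.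
    by elim: k => // k IHk kn; apply: leq_trans (cM _ kn); apply: IHk; exact: ltnW.
  case: (posnP (M 0%N)) => M0.
    rewrite schutz_det_eq0 //=; suff -> : lpp_lt n 0 M e = false by [].
    by apply/negP => /lpp_ltP/(_ 0%N n0); rewrite M0.
  have Mk k : (k < n)%N -> (0 < M k)%N by move=> /M0M; exact: leq_trans.
  rewrite schutz_det_init //=; suff -> : lpp_lt n 0 M e by [].
  by apply/lpp_ltP.
case: (posnP (M 0%N)) => M0.
  rewrite schutz_det_eq0 // (@eq_bern _ _ _ _ _ (fun=> false)) ?bern_const // => e' _.
  by apply/negP => /lpp_ltP/(_ 0%N n0); rewrite M0.
have mM k l : (k <= l)%N -> (l < n)%N -> (M k <= M l)%N.
  move=> /subnK <-; elim: (l - k)%N => //= m IHm; rewrite addSn => kn.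
  by apply: leq_trans (cM _ kn); apply: IHm; exact: ltnW.
rewrite -(schutz_mix0 _ _ _ t M (fun k => e (k, t.+1 + k)%N)) [sites _ _]/=.
suff: forall m j e, (j + m = n)%N ->
    bern p (layer n t j ++ sites n t) (lpp_lt n t.+1 M) e =
    schutz_mix n p (1 - p) t j M (fun k => e (k, t.+1 + k)%N).
  by apply; exact: add0n.
elim=> [|m IHm] j {}e.
  rewrite addn0 => ->; rewrite /layer subnn cat0s schutz_mixn.
  (* The thresholds lowered by the noise may fail to be nondecreasing, but by at most one unit. *)
  rewrite -(@schutz_near_chamber t IH n _ e).
  - apply: eq_bern => e' ee'; rewrite lpp_ltS //.
    apply/lpp_ltP/lpp_ltP => H k kn; have := H _ kn; rewrite ee' //.
      by rewrite mem_sites; lia.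
    by rewrite mem_sites; lia.
  - move=> k l /andP[kl ln]; have := mM _ _ (ltnW kl) ln.
    have := leq_b1 (e (l, t.+1 + l)%N); lia.
  - by move=> k; lia.
move=> jmn; have jn : (j < n)%N by lia.
have -> : layer n t j = (j, t.+1 + j)%N :: layer n t j.+1.
  by rewrite /layer -(subnSK jn).
rewrite cat_cons [LHS]/= !IHm; [|lia|lia].
apply/esym/schutz_mixS => //.
- by apply: leq_trans M0 (mM _ _ _ _).
- by move=> i ij; rewrite /upd xpair_eqE ltn_eqF.
- by move=> i ij; rewrite /upd xpair_eqE ltn_eqF.
- by rewrite /upd eqxx.
- by rewrite /upd eqxx.
Qed.

End Schutz.

Lemma odb_cdf_hankel (R : realType) (d : measure_display)
    (T : measurableType d) (P : probability T R) (p : R)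
    (eps : nat * nat -> {RV P >-> bool}) (x t : nat) (a b : R) :
  0 < p -> p < 1 -> iid_bernoulli p eps -> b != 0 ->
  let H := hankel x.+1 (binomial_weight p (1 - p) (t + x))
             (fun l => (l%:R - a) / b) in
  forall M : nat,
  P [set w | (odb_height R (fun i => eps i w) (t + x) x < M%:R%:E)%E] =
  (\det (H (M + x)%N) / \det (H (t + x).+1))%:E.
Proof.
move=> p0 p1 iid b0 H.
have q0 : 1 - p != 0 by rewrite subr_eq0 gt_eqF.
have [c Hc] := schutz_det_hankel (lt0r_neq0 p0) q0 x t a b0.
have PE M : P [set w | (odb_height R (fun i => eps i w) (t + x) x < M%:R%:E)%E] =
    (c * \det (H (M + x)%N))%:E.
  rewrite -Hc -(@bern_lpp R p x.+1 isT t (fun=> M) (fun=> false)) //.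
  rewrite -(prob_bern (ltW p0) (ltW p1) iid (uniq_sites _ _)).
    congr (P _); apply/seteqP; split => w /=; rewrite odb_height_lpp lte_fin ltr_nat.
      by move=> h; apply/lpp_ltP => k kx; apply: leq_ltn_trans h; exact: lpp_mono.
    by move/lpp_ltP; apply.
  move=> e e' ee'; apply/lpp_ltP/lpp_ltP => h k kx; have := h _ kx;
    by rewrite (lpp_sites kx ee').
(* Heights at time [t + x] of site [x] are at most [t], so the event with threshold [t.+1] is sure
   and fixes the constant. *)
have c1 : c * \det (H (t + x).+1) = 1.
  apply: EFin_inj; rewrite -addSn -PE -(probability_setT P); congr (P _).
  apply/seteqP; split => // w _ /=.
  by rewrite odb_height_lpp lte_fin ltr_nat ltnS lpp_le.
have d0 : \det (H (t + x).+1) != 0.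
  by apply/eqP => d0; move/eqP: c1; rewrite d0 mulr0 eq_sym oner_eq0.
move=> M; rewrite PE; congr (_%:E).
have -> : c = (\det (H (t + x).+1))^-1 by apply: (mulIf d0); rewrite c1 mulVf.
by rewrite mulrC.
Qed.

(** * Finite rank Fredholm determinants *)

Section PrincipalMinors.
Variable R : comNzRingType.

(** Sylvester's identity: both sides are the determinant of the block matrix with rows [1, - A] and
    [B, 1], factored in two ways. *)
Lemma det_1addmulC m n (A : 'M[R]_(m, n)) (B : 'M[R]_(n, m)) :
  \det (1%:M + A *m B) = \det (1%:M + B *m A).
Proof.
pose L : 'M[R]_(m + n) := block_mx 1%:M 0 B 1%:M.
pose M : 'M[R]_(m + n) := block_mx 1%:M (- A) 0 (1%:M + B *m A).
pose L' : 'M[R]_(m + n) := block_mx 1%:M (- A) 0 1%:M.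
pose M' : 'M[R]_(m + n) := block_mx (1%:M + A *m B) 0 B 1%:M.
have E : L *m (block_mx 1%:M (- A) 0 (1%:M + B *m A)) = L' *m M'.
  rewrite !mulmx_block !mul1mx !mul0mx ?mulmx0 !mulmx1 !addr0 !add0r mulNmx.
  by rewrite addrK mulmxN addrCA addNr addr0.
move/(congr1 determinant): E; rewrite !det_mulmx !det_ublock !det_lblock !det1.
by rewrite !mul1r !mulr1.
Qed.

Definition mix_rows n (G : 'M[R]_n) (S : {set 'I_n}) : 'M[R]_n :=
  \matrix_(i, j) (if i \in S then G i j else (i == j)%:R).

(** With [E] the matrix selecting the rows in the image of [f], the left matrix is
    [1 + E^T (E G - E)]. Sylvester's identity and [E E^T = 1] reduce its determinant to that of
    [E G E^T]. *)
Lemma det_mix_rows n k (G : 'M[R]_n) (f : {ffun 'I_k -> 'I_n}) : injective f ->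
  \det (mix_rows G [set f a | a : 'I_k]) = \det (\matrix_(a, b) G (f a) (f b)).
Proof.
move=> injf; pose E : 'M[R]_(k, n) := \matrix_(a, i) (f a == i)%:R.
have EE : E *m E^T = 1%:M.
  apply/matrixP => a b; rewrite !mxE (bigD1 (f a)) //= big1 => [|i /negPf ia].
    by rewrite !mxE eqxx mul1r addr0 (inj_eq injf) eq_sym.
  by rewrite !mxE eq_sym ia mul0r.
have EB m (B : 'M[R]_(n, m)) a j : (E *m B) a j = B (f a) j.
  rewrite mxE (bigD1 (f a)) //= big1 => [|i /negPf ia].
    by rewrite !mxE eqxx mul1r addr0.
  by rewrite !mxE eq_sym ia mul0r.
have -> : mix_rows G [set f a | a : 'I_k] = 1%:M + E^T *m (E *m G - E).
  have : forall a j, (E *m G - E) a j = G (f a) j - (f a == j)%:R.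
    by move=> a j; rewrite mxE EB !mxE.
  move: (E *m G - E) => B EB'; apply/matrixP => i j.
  rewrite !mxE; case: imsetP => [[a _ ->]|fi].
    rewrite (bigD1 a) //= big1 => [|b ba].
      by rewrite !mxE EB' eqxx mul1r addr0 addrC subrK.
    by rewrite !mxE (inj_eq injf) (negPf ba) mul0r.
  rewrite big1 ?addr0 // => a _; rewrite !mxE.
  by case: eqP => [E1|_]; [case: fi; exists a|rewrite mul0r].
rewrite det_1addmulC mulmxBl EE addrC subrK; congr (\det _).
apply/matrixP => a b; rewrite -mulmxA EB !mxE (bigD1 (f b)) //= big1 => [|i /negPf ib].
  by rewrite !mxE eqxx mulr1 addr0.
by rewrite !mxE eq_sym ib mulr0.
Qed.

Lemma det_ffun_eq0 n k (G : 'M[R]_n) (f : {ffun 'I_k -> 'I_n}) : ~~ injectiveb f ->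
  \det (\matrix_(a, b) G (f a) (f b)) = 0.
Proof.
move=> /injectivePn[a [b ab fab]].
by apply: (determinant_alternate ab) => c; rewrite !mxE fab.
Qed.

(** Maps that are not injective give two equal rows, and each set of size [k] is the image of
    exactly [k!] injective maps. *)
Lemma sum_det_ffun n k (G : 'M[R]_n) :
  \sum_(f : {ffun 'I_k -> 'I_n}) \det (\matrix_(a, b) G (f a) (f b)) =
  k`!%:R * \sum_(S : {set 'I_n} | #|S| == k) \det (mix_rows G S).
Proof.
rewrite (bigID (fun f : {ffun 'I_k -> 'I_n} => injectiveb f)) /=.
rewrite [X in _ + X]big1 ?addr0; last by move=> f; exact: det_ffun_eq0.
rewrite (partition_big (fun f : {ffun 'I_k -> 'I_n} => [set f a | a : 'I_k])
  (fun S : {set 'I_n} => #|S| == k)) /=; last first.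
  by move=> f /injectiveP injf; rewrite card_imset // card_ord.
rewrite mulr_sumr; apply: eq_bigr => S /eqP Sk.
rewrite (eq_bigr (fun=> \det (mix_rows G S))); last first.
  by move=> f /andP[/injectiveP injf /eqP <-]; rewrite det_mix_rows.
rewrite sumr_const -[LHS]mulr_natl; congr (_%:R * _).
transitivity #|[set f : {ffun 'I_k -> 'I_n} in ffun_on (mem S) | injectiveb f]|.
  apply: eq_card => f; rewrite !inE unfold_in /= andbC.
  case: (boolP (injectiveb f)) => [/injectiveP injf|]; last by rewrite !andbF.
  rewrite !andbT; apply/eqP/ffun_onP => [<- a|fS]; first exact: imset_f.
  apply/eqP; rewrite eqEcard card_imset // card_ord Sk leqnn andbT.
  by apply/fintype.subsetP => i /imsetP[a _ ->].
by rewrite card_inj_ffuns_on card_ord Sk ffactnn.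
Qed.

(** Multilinearity in the rows: [S] records the rows in which [- G] is chosen instead of the
    identity. *)
Lemma det_1sub_minors n (G : 'M[R]_n) :
  \det (1%:M - G) = \sum_(S : {set 'I_n}) (-1) ^+ #|S| * \det (mix_rows G S).
Proof.
rewrite /determinant; under [RHS]eq_bigr => S _ do rewrite mulr_sumr.
rewrite exchange_big /=; apply: eq_bigr => s _.
under [RHS]eq_bigr => S _ do rewrite mulrCA.
rewrite -mulr_sumr; congr (_ * _).
under eq_bigr => i _ do rewrite !mxE addrC.
rewrite bigA_distr; apply: eq_bigr => S _.
rewrite (eq_bigr (fun i => (if i \in S then -1 else 1) * mix_rows G S i (s i))).
  rewrite big_split /=; congr (_ * _).
  by rewrite -big_mkcond prodr_const.
by move=> i _; rewrite !mxE; case: ifP => _; rewrite ?mulN1r ?mul1r.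
Qed.

Lemma sum_minors_card n (G : 'M[R]_n) N : (n < N)%N ->
  \sum_(k < N) (-1) ^+ k * (\sum_(S : {set 'I_n} | #|S| == k) \det (mix_rows G S)) =
  \det (1%:M - G).
Proof.
case: N => // N nN; rewrite det_1sub_minors.
rewrite (partition_big (fun S : {set 'I_n} => inord #|S| : 'I_N.+1) predT) //=.
have iE (S : {set 'I_n}) : nat_of_ord (inord #|S| : 'I_N.+1) = #|S|.
  by rewrite inordK //; apply: leq_ltn_trans nN; rewrite -[leqRHS]card_ord max_card.
apply: eq_bigr => k _; rewrite mulr_sumr; apply: eq_big => [S|S /eqP <- //].
by rewrite -val_eqE /= iE.
Qed.

End PrincipalMinors.

(** * Fredholm series of finite rank kernels *)

Section FiniteRank.
Variables (R : realType) (D : set R).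
Hypothesis mD : measurable D.
Let mu := @lebesgue_measure R.

Lemma integrable_sumR (C : finType) (g : C -> R -> R) :
  (forall c, mu.-integrable D (EFin \o g c)) ->
  mu.-integrable D (EFin \o (fun y => \sum_c g c y)).
Proof.
move=> ig; have -> : EFin \o (fun y => \sum_c g c y) =
    (fun y => \sum_(c <- index_enum C) (EFin \o g c) y)%E.
  by apply/funext => y /=; rewrite -sumEFin.
exact: integrable_sum.
Qed.

Lemma integrableZlR (k : R) (g : R -> R) : mu.-integrable D (EFin \o g) ->
  mu.-integrable D (EFin \o (fun y => k * g y)).
Proof.
move=> ig; have -> : EFin \o (fun y => k * g y) =
    (fun y => k%:E * (EFin \o g) y)%E by apply/funext => y /=; rewrite EFinM.
exact: integrableZl.
Qed.

Lemma Rintegral_sumR (C : finType) (g : C -> R -> R) :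
  (forall c, mu.-integrable D (EFin \o g c)) ->
  \int[mu]_(y in D) (\sum_c g c y) = \sum_c \int[mu]_(y in D) g c y.
Proof.
move=> ig; rewrite /Rintegral.
under eq_integral => y _ do rewrite -sumEFin.
rewrite integral_sum // -sum_fine // => c _.
by apply: integrable_fin_num => //; exact: ig.
Qed.

Lemma iter_integral_sum_prod k (C : finType) (a : C -> R)
    (g : C -> 'I_k -> R -> R) :
  (forall c i, mu.-integrable D (EFin \o g c i)) ->
  iter_integral D k (fun u => \sum_c a c * \prod_(i < k) g c i u`_i) =
  \sum_c a c * \prod_(i < k) \int[mu]_(y in D) g c i y.
Proof.
elim: k a g => [|k IH] a g ig /=.
  by apply: eq_bigr => c _; rewrite !big_ord0.
transitivity (\int[mu]_(y in D) (\sum_c (a c *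
    \prod_(i < k) \int[mu]_(z in D) g c (lift ord0 i) z) * g c ord0 y)).
  apply: eq_Rintegral => y _.
  transitivity (iter_integral D k (fun u => \sum_c (a c * g c ord0 y) *
      \prod_(i < k) g c (lift ord0 i) u`_i)).
    congr (iter_integral D k _); apply/funext => u; apply: eq_bigr => c _.
    by rewrite big_ord_recl /= mulrA.
  rewrite (IH (fun c => a c * g c ord0 y) (fun c i => g c (lift ord0 i))) //.
  by apply: eq_bigr => c _; rewrite mulrAC.
rewrite Rintegral_sumR.
  apply: eq_bigr => c _; rewrite RintegralZl // big_ord_recl -mulrA.
  by congr (_ * _); rewrite mulrC.
by move=> c; exact: integrableZlR.
Qed.

(** After expanding the determinant and the kernel, reindexing the second factors by the permutation
    collects everything that depends on one variable. The integrals separate, and the sum over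
    permutations is the determinant of a Gram matrix. *)
Lemma iter_integral_det k n (phi : 'I_n -> R -> R) :
  (forall i j, mu.-integrable D (EFin \o (fun y => phi i y * phi j y))) ->
  iter_integral D k (fun u => \det (\matrix_(i < k, j < k)
     \sum_(l < n) phi l u`_i * phi l u`_j)) =
  \sum_(f : {ffun 'I_k -> 'I_n}) \det (\matrix_(a, b)
     \int[mu]_(y in D) (phi (f a) y * phi (f b) y)).
Proof.
move=> iphi.
transitivity (iter_integral D k (fun u =>
    \sum_(c : 'S_k * {ffun 'I_k -> 'I_n}) (-1) ^+ c.1 * \prod_(i < k)
      (fun y => phi (c.2 i) y * phi (c.2 (c.1^-1 i)%g) y) u`_i)).
  congr (iter_integral D k _); apply/funext => u.
  rewrite /determinant -(pair_bigA _ (fun s (f : {ffun 'I_k -> 'I_n}) => (-1) ^+ odd_perm s *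
    \prod_(i < k) (phi (f i) u`_i * phi (f ((s^-1)%g i)) u`_i))) /=.
  apply: eq_bigr => s _; rewrite -mulr_sumr; congr (_ * _).
  under eq_bigr => i _ do rewrite mxE.
  rewrite bigA_distr_bigA /=; apply: eq_bigr => f _.
  rewrite !big_split /=; congr (_ * _).
  rewrite [RHS](reindex_inj (@perm_inj _ s)) /=.
  by apply: eq_bigr => i _; rewrite permK.
rewrite (iter_integral_sum_prod (fun c : 'S_k * {ffun 'I_k -> 'I_n} =>
  (-1) ^+ odd_perm c.1) (g := fun c i y => phi (c.2 i) y * phi (c.2 (c.1^-1 i)%g) y)) //.
rewrite -(pair_bigA _ (fun s (f : {ffun 'I_k -> 'I_n}) => (-1) ^+ odd_perm s *
    \prod_(i < k) \int[mu]_(y in D) (phi (f i) y * phi (f ((s^-1)%g i)) y))) /=.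
rewrite exchange_big /=; apply: eq_bigr => f _; rewrite /determinant.
rewrite (reindex_inj (@invg_inj _)) /=; apply: eq_bigr => s _.
rewrite odd_permV invgK; congr (_ * _).
by apply: eq_bigr => i _; rewrite mxE.
Qed.

(** No subset of ['I_n] has more than [n] elements, so the partial sums of the series are eventually
    constant. *)
Lemma fredholm_det_finite_rank n (phi : 'I_n -> R -> R) :
  (forall i j, mu.-integrable D (EFin \o (fun y => phi i y * phi j y))) ->
  fredholm_det D (fun x y => \sum_(l < n) phi l x * phi l y) =
  \det (1%:M - \matrix_(i, j) \int[mu]_(y in D) (phi i y * phi j y)).
Proof.
move=> iphi; set G := \matrix_(i, j) _.
apply/cvg_lim => //; apply: cvg_near_cst; near=> N.
rewrite /series /= big_mkord.
rewrite -(@sum_minors_card _ n G N); last by near: N; exact: nbhs_infty_gt.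
apply: eq_bigr => k _; rewrite iter_integral_det //.
transitivity ((-1) ^+ k / k`!%:R *
   \sum_(f : {ffun 'I_k -> 'I_n}) \det (\matrix_(a, b) G (f a) (f b))).
  congr (_ * _); apply: eq_bigr => f _; congr (\det _).
  by apply/matrixP => a b; rewrite !mxE.
rewrite sum_det_ffun mulrA divfK // pnatr_eq0 -lt0n; exact: fact_gt0.
Unshelve. all: by end_near.
Qed.

End FiniteRank.

(** * Gaussian integrals and Hermite functions *)

Section GaussBounds.
Variable R : realType.
Let mu := @lebesgue_measure R.

Lemma exprn_le_expR (y : R) n : 0 <= y -> y ^+ n <= n`!%:R * expR y.
Proof.
move=> y0; case: n => [|n].
  by rewrite expr0 mul1r -expR0 ler_expR.
rewrite mulrC -ler_pdivrMr ?ltr0n ?fact_gt0 //.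
by apply: le_trans (expR_ge1Dxn n y0); rewrite lerDr.
Qed.

Lemma exprn_sqr_le_expR (c : R) m v : 0 < c ->
  (v ^+ 2) ^+ m <= m`!%:R / c ^+ m * expR (c * v ^+ 2).
Proof.
move=> c0; have y0 : 0 <= c * v ^+ 2 by rewrite mulr_ge0 ?sqr_ge0 // ltW.
have := exprn_le_expR m y0; rewrite exprMn -ler_pdivlMl ?exprn_gt0 // => H.
by apply: (le_trans H); rewrite mulrA [_^-1 * _]mulrC.
Qed.

(** Provides the integrable majorant for every use of dominated convergence. With [w = v^2], one has
    [|v|^k <= 1 + w^k], and the constant adds the bounds on the four powers of [w] in
    [(1 + w^k) (1 + w)]. *)
Lemma normX_expR_le k (c : R) : 0 < c -> exists2 C : R, 0 <= C &
  forall v, `|v| ^+ k * expR (- (c * v ^+ 2)) <= C * (oneDsqr v)^-1.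
Proof.
move=> c0; pose a m := m`!%:R / c ^+ m.
have a0 m : 0 <= a m by rewrite divr_ge0 ?ler0n ?exprn_ge0 ?ltW.
exists (a 0%N + a 1%N + a k + a k.+1); first by rewrite !addr_ge0.
move=> v; have o0 : 0 < oneDsqr v by apply: lt_le_trans (oneDsqr_ge1 v).
rewrite ler_pdivlMr // expRN mulrAC ler_pdivrMr ?expR_gt0 //.
apply: (@le_trans _ _ ((1 + (v ^+ 2) ^+ k) * oneDsqr v)).
  rewrite ler_pM2r // -(real_normK (num_real v)) exprAC.
  set y := `|v| ^+ k; have y0 : 0 <= y by rewrite exprn_ge0.
  by nra.
rewrite /oneDsqr; set w := v ^+ 2.
have -> : (1 + w ^+ k) * (1 + w) = w ^+ 0 + w ^+ 1 + w ^+ k + w ^+ k.+1.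
  by rewrite expr0 expr1 exprS; ring.
have H m := @exprn_sqr_le_expR c m v c0.
by rewrite !mulrDl !lerD // H.
Qed.

Lemma integrable_oneDsqrV (C : R) : 0 <= C ->
  mu.-integrable setT (EFin \o (fun v => C * (oneDsqr v)^-1)).
Proof.
move=> C0.
have cV : continuous (fun v : R => (oneDsqr v)^-1) by exact: continuous_oneDsqrV.
have i1 : mu.-integrable setT (EFin \o (fun v : R => (oneDsqr v)^-1)).
  apply/integrableP; split.
    by apply/measurable_EFinP; exact: continuous_measurable_fun.
  have V0 (v : R) : 0 <= (oneDsqr v)^-1 by rewrite invr_ge0.
  under eq_integral => v _ do rewrite /= ger0_norm //.
  rewrite ge0_symfun_integralT //=; last by move=> v /=; rewrite /oneDsqr sqrrN.
  rewrite (_ : [set x | _] = `[0, +oo[%classic); last first.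
    by apply/seteqP; split => x/=; rewrite in_itv/= andbT.
  by rewrite integral0y_oneDsqr -EFinM ltry.
exact: integrableZlR.
Qed.

Definition gpoly (f : {poly R}) (x : R) := f.[x] * gauss_fun x.

Lemma gpoly_le f : exists2 C : R, 0 <= C &
  forall x, `|gpoly f x| <= C * (oneDsqr x)^-1.
Proof.
have /choice[C HC] : forall k, exists C : R, 0 <= C /\
    forall v, `|v| ^+ k * gauss_fun v <= C * (oneDsqr v)^-1.
  move=> k; have [C C0 HC] := normX_expR_le k (@ltr01 R).
  by exists C; split => // v; have := HC v; rewrite mul1r.
exists (\sum_(i < size f) `|f`_i| * C i).
  by apply: sumr_ge0 => i _; rewrite mulr_ge0 ?normr_ge0 //; case: (HC i).
move=> x; rewrite /gpoly horner_coef normrM (ger0_norm (gauss_fun_ge0 x)).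
apply: (@le_trans _ _ (\sum_(i < size f) `|f`_i * x ^+ i| * gauss_fun x)).
  by rewrite -mulr_suml ler_wpM2r ?gauss_fun_ge0 // ler_norm_sum.
rewrite mulr_suml; apply: ler_sum => i _.
rewrite normrM normrX -!mulrA ler_wpM2l //.
by case: (HC i).
Qed.

Lemma continuous_gpoly f : continuous (gpoly f).
Proof.
by move=> x; apply: cvgM; [exact: continuous_horner|exact: continuous_gauss_fun].
Qed.

Lemma integrable_gpolyT f : mu.-integrable setT (EFin \o gpoly f).
Proof.
have [C C0 HC] := gpoly_le f.
apply: (le_integrable measurableT _ _ (integrable_oneDsqrV C0)).
  by apply/measurable_EFinP; apply: continuous_measurable_fun; exact: continuous_gpoly.
by move=> x _ /=; rewrite lee_fin (le_trans (HC x)) // ler_norm.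
Qed.

Lemma integrable_gpoly D f : measurable D -> mu.-integrable D (EFin \o gpoly f).
Proof. by move=> mD; apply: integrableS (integrable_gpolyT f). Qed.

End GaussBounds.

(** * Integration by parts, Hermite orthogonality and Gram determinants *)

Section GaussFunctional.
Variable R : realType.
Let mu := @lebesgue_measure R.
Implicit Types (f g : {poly R}) (D : set R).

Definition gint D f : R := \int[mu]_(x in D) gpoly f x.

Lemma gint_lin D a b f g : measurable D ->
  gint D (a *: f + b *: g) = a * gint D f + b * gint D g.
Proof.
move=> mD; have ig f := integrable_gpoly f mD.
rewrite /gint -!RintegralZl // -RintegralD //; try exact: integrableZlR.
by apply: eq_Rintegral => x _; rewrite /gpoly hornerD !hornerZ; ring.
Qed.

Lemma gintB D f g : measurable D -> gint D (f - g) = gint D f - gint D g.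
Proof.
by move=> mD; have := gint_lin 1 (-1) f g mD; rewrite scale1r scaleN1r mul1r mulN1r.
Qed.

Lemma gintC c : gint setT c%:P = c * Num.sqrt pi.
Proof.
rewrite /gint; under eq_Rintegral => x _ do rewrite /gpoly hornerC.
rewrite RintegralZl //; last exact: integrableT_gauss.
by rewrite {1}/Rintegral integralT_gauss.
Qed.

Lemma is_derive_gpoly f (x : R) :
  is_derive x 1 (gpoly f) (gpoly (f^`() - 2%:R *: ('X * f)) x).
Proof.
have dg : is_derive x (1 : R) (@gauss_fun R) (- (2 * x) * gauss_fun x).
  rewrite /gauss_fun; apply: is_derive_eq.
  have E (e y : R) : e * - (y * 1 + y * 1) = - (2 * y) * e by ring.
  exact: E.
apply: is_derive_eq.
have E (u y e v : R) : u * (- (2 * y) * e) + e * v = (v - 2 * (y * u)) * e by ring.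
by rewrite /gpoly hornerD hornerN hornerZ hornerM hornerX; exact: E.
Qed.

(** The integrand is the derivative of [gpoly f]. Its integral over the growing intervals [I n] is a
    boundary term tending to 0, and also tends to the full integral by dominated convergence. *)
Lemma gint_deriv f : gint setT (f^`() - 2%:R *: ('X * f)) = 0.
Proof.
set g := f^`() - _.
pose b (n : nat) : R := n.+1%:R.
pose a (n : nat) : R := gpoly f (b n) - gpoly f (- b n).
pose I (n : nat) : set R := `[- b n, b n]%classic.
have FTC n : (\int[mu]_(x in I n) (gpoly g x)%:E)%E = (a n)%:E.
  rewrite (@continuous_FTC2 _ (gpoly g) (gpoly f)) //.
  - by rewrite -subr_gt0 opprK addr_gt0 // ltr0n.
  - by apply: continuous_subspaceT; exact: continuous_gpoly.
  - split.
    + by move=> x _; have [] := is_derive_gpoly f x.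
    + by apply: cvg_at_right_filter; exact: continuous_gpoly.
    + by apply: cvg_at_left_filter; exact: continuous_gpoly.
  - by move=> x _; rewrite derive1E; have [_ ->] := is_derive_gpoly f x.
pose h (n : nat) : R -> \bar R := (EFin \o gpoly g) \_ (I n).
have mg : measurable_fun setT (EFin \o gpoly g).
  exact: (measurable_int mu (integrable_gpolyT g)).
have mI n : measurable (I n) by exact: measurable_itv.
have mh n : measurable_fun setT (h n).
  by apply: (measurable_restrictT _ (mI n)).1; exact: measurable_funTS.
have hcv : {ae mu, forall x, setT x -> h ^~ x @ \oo --> (EFin \o gpoly g) x}.
  apply: aeW => x _; apply: cvg_near_cst; near=> n.
  rewrite /h /= patchE mem_set //= /I /= in_itv /= -ler_norml.
  near: n; exists (Num.truncn `|x|) => // n /= xn.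
  by rewrite ltW // (lt_le_trans (truncnS_gt _)) // ler_nat.
have hle : {ae mu, forall x n, setT x ->
    (`|h n x| <= (abse \o (EFin \o gpoly g)) x)%E}.
  apply: aeW => x n _; rewrite /h /= patchE; case: ifP => // _.
  by rewrite abse0 lee_fin.
have [_ _ hI] := @dominated_convergence _ _ _ mu setT measurableT h
  (EFin \o gpoly g) _ mh mg hcv (integrable_abse (integrable_gpolyT g)) hle.
move: hI => /=.
under eq_fun => n.
  have -> : (\int[mu]_(x in setT) h n x = (a n)%:E)%E.
    by rewrite /h -integral_mkcond FTC.
  over.
have fin : (\int[mu]_(x in setT) (EFin \o gpoly g) x)%E \is a fin_num.
  by apply: integrable_fin_num => //; exact: integrable_gpolyT.
rewrite -(fineK fin) => /fine_cvg aI.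
have {}aI : a n @[n --> \oo] --> gint setT g by exact: aI.
have [C C0 HC] := gpoly_le f.
have a0 : a n @[n --> \oo] --> 0.
  have hC : (2 * C * harmonic n) @[n --> \oo] --> (0 : R).
    rewrite -(mulr0 (2 * C)); apply: cvgM; [exact: cvg_cst|exact: cvg_harmonic].
  apply: norm_cvg0; apply: squeeze_cvgr (cvg_cst 0) hC; near=> n.
  rewrite normr_ge0 andTb /a; apply: (le_trans (ler_normB _ _)).
  have bn y : y ^+ 2 = b n ^+ 2 -> `|gpoly f y| <= C * harmonic n.
    move=> yb; apply: (le_trans (HC y)); rewrite ler_wpM2l // /harmonic /=.
    have oy : 0 < oneDsqr y by exact: lt_le_trans ltr01 (oneDsqr_ge1 y).
    rewrite lef_pV2 ?posrE ?ltr0n //.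
    by rewrite /oneDsqr yb -natrX -(natrD _ 1) ler_nat; nia.
  have := bn (b n) erefl; have := bn (- b n) (sqrrN _); lra.
by rewrite -(cvg_lim _ aI) //; exact: cvg_lim.
Unshelve. all: by end_near.
Qed.

Lemma size_hermite k : (size (hermite R k) <= k.+1)%N.
Proof.
elim: k => [|k IH] /=; first by rewrite size_poly1.
rewrite (leq_trans (size_polyD _ _)) // geq_max size_polyN; apply/andP; split.
  by rewrite (leq_trans (size_scale_leq _ _)) // (leq_trans (size_polyMleq _ _)) // size_polyX.
case: (eqVneq (hermite R k) 0) => [->|/lt_size_deriv/ltnW sd].
  by rewrite deriv0 size_poly0.
exact: leq_trans sd (leq_trans IH (leqnSn _)).
Qed.

Lemma coef_hermite k : (hermite R k)`_k = 2 ^+ k.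
Proof.
elim: k => [|k IH] /=; first by rewrite coef1.
rewrite coefB coefZ coefXM /= IH coef_deriv nth_default ?mul0rn ?subr0 ?exprS //.
by rewrite (leq_trans (size_hermite k)).
Qed.

(** Each step of the recursion for [hermite] is an integration by parts that moves one derivative
    onto [g]. Orthogonality and the norms follow by taking [g] to be a Hermite polynomial. *)
Lemma gint_hermite k g : gint setT (hermite R k * g) = gint setT g^`(k).
Proof.
elim: k g => [|k IH] g; first by rewrite mul1r.
have := gint_deriv (hermite R k * g); rewrite derivM => E.
transitivity (gint setT (hermite R k * g^`()) - gint setT
  ((hermite R k)^`() * g + hermite R k * g^`() - 2%:R *: ('X * (hermite R k * g)))).
  rewrite -gintB //; congr (gint _ _); rewrite [hermite R k.+1]/=.
  by rewrite mulrBl -scalerAl mulrA; ring.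
by rewrite E subr0 IH -derivSn.
Qed.

Lemma gint_hermite_orth i j : (i < j)%N ->
  gint setT (hermite R i * hermite R j) = 0.
Proof.
move=> ij; rewrite mulrC gint_hermite derivn_poly0; last first.
  exact: leq_trans (size_hermite i) ij.
by have := gintC 0; rewrite mul0r.
Qed.

Lemma gint_hermite_sqr k :
  gint setT (hermite R k * hermite R k) = 2 ^+ k * k`!%:R * Num.sqrt pi.
Proof.
rewrite gint_hermite -gintC; congr (gint _ _); apply/polyP => i.
rewrite coef_derivn coefC; case: i => [|i] /=.
  by rewrite addn0 coef_hermite ffactnn mulr_natr.
by rewrite nth_default ?mul0rn // (leq_trans (size_hermite k)) //; lia.
Qed.

Definition hermite_nrm k : R := Num.sqrt (2 ^+ k * k`!%:R * Num.sqrt pi).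

Lemma hermite_funM i j (x : R) : hermite_fun i x * hermite_fun j x =
  gpoly ((hermite_nrm i)^-1 *: hermite R i * ((hermite_nrm j)^-1 *: hermite R j)) x.
Proof.
rewrite /hermite_fun -/(hermite_nrm i) -/(hermite_nrm j) /gpoly hornerM !hornerZ.
have -> : gauss_fun x = expR (- (x ^+ 2 / 2)) * expR (- (x ^+ 2 / 2)).
  by rewrite -expRD /gauss_fun; congr expR; lra.
by ring.
Qed.

Definition hermite_gram n D : 'M[R]_n :=
  \matrix_(i, j) \int[mu]_(y in D) (hermite_fun i y * hermite_fun j y).

Definition gauss_hankel n D : 'M[R]_n := \matrix_(i, j) gint D 'X^(i + j).

Lemma hermite_gramE n D (i j : 'I_n) :
  hermite_gram n D i j = gint D
   ((hermite_nrm i)^-1 *: hermite R i * ((hermite_nrm j)^-1 *: hermite R j)).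
Proof. by rewrite mxE; apply: eq_Rintegral => x _; rewrite hermite_funM. Qed.

Lemma hermite_gramT n : hermite_gram n setT = 1%:M.
Proof.
apply/matrixP => i j; rewrite hermite_gramE -scalerAl -scalerAr scalerA.
have gZ a f : gint setT (a *: f) = a * gint setT f.
  by have := gint_lin a 0 f 0 measurableT; rewrite scaler0 addr0 mul0r addr0.
rewrite gZ mxE; case: (ltngtP i j) => ij.
- by rewrite gint_hermite_orth // mulr0 -val_eqE ltn_eqF.
- by rewrite [hermite R i * _]mulrC gint_hermite_orth // mulr0 -val_eqE gtn_eqF.
- rewrite (val_inj ij) eqxx gint_hermite_sqr -invfM.
  rewrite -expr2 sqr_sqrtr ?mulVf //.
  by rewrite !mulf_neq0 ?expf_neq0 ?pnatr_eq0 -?lt0n ?fact_gt0 // gt_eqF // sqrtr_gt0 pi_gt0.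
Qed.

Lemma hermite_gram_hankel n D : measurable D ->
  hermite_gram n D =
  (\matrix_(i, j) ((hermite_nrm i)^-1 *: hermite R i)`_j) *m gauss_hankel n D *m
  (\matrix_(i < n, j < n) ((hermite_nrm i)^-1 *: hermite R i)`_j)^T.
Proof.
move=> mD; apply/matrixP => i j; rewrite hermite_gramE.
pose u k := (hermite_nrm k)^-1 *: hermite R k.
have su (k : 'I_n) : u k = \sum_(a < n) (u k)`_a *: 'X^a.
  rewrite -poly_def; apply/polyP => a; rewrite coef_poly; case: ltnP => // na.
  rewrite nth_default // (leq_trans (size_scale_leq _ _)) //.
  by rewrite (leq_trans (size_hermite k)) // (leq_trans (ltn_ord k)).
rewrite -/(u i) -/(u j).
transitivity (\sum_(b < n) \sum_(a < n) (u i)`_a * (u j)`_b * gint D 'X^(a + b)).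
  rewrite {1}(su i) {1}(su j) mulr_sumr.
  have gsum (F : 'I_n -> {poly R}) : gint D (\sum_(b < n) F b) = \sum_(b < n) gint D (F b).
    rewrite /gint -Rintegral_sumR //; last by move=> c; exact: integrable_gpoly.
    by apply: eq_Rintegral => x _; rewrite /gpoly horner_sum mulr_suml.
  have gZ a f : gint D (a *: f) = a * gint D f.
    by have := gint_lin a 0 f 0 mD; rewrite scaler0 addr0 mul0r addr0.
  rewrite gsum; apply: eq_bigr => b _; rewrite mulr_suml gsum; apply: eq_bigr => a _.
  by rewrite -scalerAl -scalerAr scalerA gZ exprD.
rewrite mxE; apply: eq_bigr => b _; rewrite !mxE mulr_suml; apply: eq_bigr => a _.
by rewrite !mxE mulrAC.
Qed.

(** A change of basis with coefficient matrix [A] relates each Gram determinant to a Hankel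
    determinant. Over the whole line the Gram matrix is the identity, which shows that the
    denominator is nonzero and eliminates [A]. *)
Lemma F_GUE_hankel n (s : R) :
  \det (gauss_hankel n setT) != 0 /\
  F_GUE n s = \det (gauss_hankel n `]-oo, s / Num.sqrt 2]) /
              \det (gauss_hankel n setT).
Proof.
set z := s / Num.sqrt 2; set u := fun k : nat => (hermite_nrm k)^-1 *: hermite R k.
pose A : 'M[R]_n := \matrix_(i < n, j < n) (u i)`_j.
have dG D : measurable D ->
    \det (hermite_gram n D) = \det A * \det (gauss_hankel n D) * \det A.
  by move=> mD; rewrite hermite_gram_hankel // !det_mulmx det_tr.
have := dG _ measurableT; rewrite hermite_gramT det1 => E1.
have d0 : \det (gauss_hankel n setT) != 0.
  by apply/eqP => d0; move: E1; rewrite d0 mulr0 mul0r; apply/eqP; exact: oner_neq0.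
split => //; have mz : measurable (`]-oo, z] : set R) by exact: measurable_itv.
have mz' : measurable (`]z, +oo[ : set R) by exact: measurable_itv.
have ih D i j : measurable D ->
   mu.-integrable D (EFin \o (fun y => hermite_fun i y * hermite_fun j y)).
  move=> mD; under eq_fun => y do rewrite hermite_funM.
  exact: integrable_gpoly.
have -> : F_GUE n s = \det (hermite_gram n `]-oo, z]).
  rewrite /F_GUE /hermite_kernel -/z.
  rewrite (@fredholm_det_finite_rank _ _ mz' n (fun i => hermite_fun i)); last first.
    by move=> i j; exact: ih.
  (* Writing the identity as the Gram matrix over the whole line turns its difference with the Gram
     matrix over []z, +oo[] into the one over the complement. *)
  congr (\det _); rewrite -(hermite_gramT n); apply/matrixP => i j; rewrite !mxE.
  have <- : `]-oo, z] `|` `]z, +oo[ = [set: R].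
    by rewrite -set_itvNyy -itv_bndbnd_setU.
  rewrite Rintegral_setU //; first by rewrite addrK.
    by apply: ih; exact: measurableU.
  by apply/disj_setPS => x /=; rewrite !in_itv /= andbT => -[]; rewrite leNgt => /negP.
rewrite dG //; apply: (mulIf d0); rewrite divfK //.
by rewrite -[RHS]mulr1 E1; ring.
Qed.

End GaussFunctional.

(** * Asymptotics of the binomial weights *)

Section BinomialWeight.
Variables (R : realType) (p : R).
Hypotheses (p0 : 0 < p) (p1 : p < 1).
Let q : R := 1 - p.
Let w T L := binomial_weight p q T L.
Let y T L : R := L%:R - p * T%:R.
(** The integer part of the mean, within one unit of the true mode; the weight there serves as
    reference. *)
Definition mode T := Num.truncn (p * T%:R).

Let q0 : 0 < q. Proof. by rewrite subr_gt0. Qed.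

Lemma binomial_weight_ge0 T L : 0 <= w T L.
Proof. by rewrite /w /binomial_weight !mulr_ge0 ?exprn_ge0 // ltW. Qed.

Lemma binomial_weight_gt0 T L : (L <= T)%N -> 0 < w T L.
Proof. by move=> LT; rewrite /w /binomial_weight !mulr_gt0 ?exprn_gt0 // ltr0n bin_gt0. Qed.

(** The quotient of consecutive weights in terms of the deviation [y] from the mean,
    cross-multiplied so that it also holds for [L >= T]. *)
Lemma binomial_weight_rec T L :
  w T L.+1 * (q * (p * T%:R + y T L + 1)) = w T L * (p * (q * T%:R - y T L)).
Proof.
have -> : p * T%:R + y T L + 1 = L.+1%:R by rewrite /y -natr1; ring.
have -> : q * T%:R - y T L = T%:R - L%:R by rewrite /y /q; ring.
rewrite /w /binomial_weight; case: (ltngtP L T) => LT.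
- have h := congr1 (fun m => m%:R : R) (mul_bin_left T L).
  rewrite !natrM natrB in h; last exact: ltnW.
  have -> : q ^+ (T - L) = q ^+ (T - L.+1) * q by rewrite -exprSr subnSK.
  rewrite exprSr; transitivity (L.+1%:R * 'C(T, L.+1)%:R *
    (p ^+ L * p * q ^+ (T - L.+1) * q)); first by ring.
  by rewrite h; ring.
- by rewrite !bin_small ?mulr0n ?mul0r //; exact: ltnW.
- by rewrite LT bin_small // subrr mulr0n !(mulr0, mul0r).
Qed.

Lemma mode_itv T : -1 < y T (mode T) <= 0.
Proof.
have /truncn_itv := mulr_ge0 (ltW p0) (ler0n R T).
by rewrite /y /mode -natr1; lra.
Qed.

Lemma mode_le T : (mode T <= T)%N.
Proof.
have /andP[_] := mode_itv T; rewrite /y -(ler_nat R).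
have := mulr_ge0 (ltW q0) (ler0n R T); rewrite /q; nra.
Qed.

Lemma ler_1B_expRN (x : R) : 1 - x <= expR (- x).
Proof. exact: expR_ge1Dx. Qed.

Lemma weight_step_right T L : (0 < T)%N -> -1 <= y T L ->
  w T L.+1 <= w T L * expR (- (y T L / (q * T%:R))).
Proof.
rewrite -(ltr_nat R) => T0 y1; have W := binomial_weight_ge0 T L.
have W1 := binomial_weight_ge0 T L.+1; have E := binomial_weight_rec T L.
have pqT : 0 < p * q * T%:R by rewrite !mulr_gt0.
rewrite -(ler_pM2r pqT).
apply: (@le_trans _ _ (w T L * (p * (q * T%:R - y T L)))).
  rewrite -E ler_wpM2l // mulrAC [p * T%:R * q]mulrC ler_wpM2l //; first exact: ltW.
  by rewrite -addrA lerDl; lra.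
rewrite -[leRHS]mulrA ler_wpM2l //.
have -> : p * (q * T%:R - y T L) = (1 - y T L / (q * T%:R)) * (p * q * T%:R).
  by field; rewrite !gt_eqF.
by rewrite ler_pM2r // ler_1B_expRN.
Qed.

Lemma weight_step_left T L : (0 < T)%N -> y T L <= 0 ->
  w T L <= w T L.+1 * expR ((y T L + 1) / (p * T%:R)).
Proof.
rewrite -(ltr_nat R) => T0 y1; have W := binomial_weight_ge0 T L.
have W1 := binomial_weight_ge0 T L.+1; have E := binomial_weight_rec T L.
have pqT : 0 < p * q * T%:R by rewrite !mulr_gt0.
rewrite -(ler_pM2r pqT).
apply: (@le_trans _ _ (w T L.+1 * (q * (p * T%:R + y T L + 1)))).
  rewrite E ler_wpM2l // -[leLHS]mulrA ler_wpM2l //; first exact: ltW.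
  by rewrite lerDl oppr_ge0.
rewrite -[leRHS]mulrA ler_wpM2l //.
have -> : q * (p * T%:R + y T L + 1) = (1 + (y T L + 1) / (p * T%:R)) * (p * q * T%:R).
  by field; rewrite !gt_eqF.
by rewrite ler_pM2r // expR_ge1Dx.
Qed.

(** Accumulated one-step bounds: [i] steps to the right of [mode T] the deviation exceeds [i - 1],
    and the sum of [2 (i - 1)] over [i < d] is [d^2 - 3 d]. *)
Lemma weight_right T d : (0 < T)%N ->
  w T (mode T + d) <= w T (mode T) * expR (- ((d%:R ^+ 2 - 3 * d%:R) / (2 * q * T%:R))).
Proof.
move=> T0; elim: d => [|d IH].
  by rewrite addn0 expr0n /= mulr0 subr0 mul0r oppr0 expR0 mulr1.
have /andP[] := mode_itv T; rewrite addnS; set L := (mode T + d)%N.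
have yE : y T L = y T (mode T) + d%:R by rewrite /y /L natrD; ring.
have d0 : 0 <= d%:R :> R by [].
move=> ym0 ym1; apply: le_trans (weight_step_right T0 _) _; first by rewrite yE; lra.
apply: le_trans (ler_wpM2r (expR_ge0 _) IH) _.
rewrite -[leLHS]mulrA ler_wpM2l ?binomial_weight_ge0 // -expRD ler_expR -opprD lerN2.
have T0' : 0 < T%:R :> R by rewrite ltr0n.
have -> : y T L / (q * T%:R) = 2 * y T L / (2 * q * T%:R) by field; rewrite !gt_eqF.
rewrite -mulrDl ler_pM2r ?invr_gt0 ?mulr_gt0 // -natr1 yE; lra.
Qed.

Lemma weight_left T d : (0 < T)%N -> (d <= mode T)%N ->
  w T (mode T - d) <= w T (mode T) * expR (- ((d%:R ^+ 2 - d%:R) / (2 * p * T%:R))).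
Proof.
move=> T0; elim: d => [|d IH] dm.
  by rewrite subn0 expr0n /= subr0 mul0r oppr0 expR0 mulr1.
have /andP[] := mode_itv T; set L := (mode T - d.+1)%N.
have LS : L.+1 = (mode T - d)%N by rewrite /L subnSK.
have yE : y T L = y T (mode T) - d.+1%:R by rewrite /y /L natrB //; ring.
have d0 : 0 <= d%:R :> R by [].
move=> ym0 ym1; apply: le_trans (weight_step_left T0 _) _.
  by rewrite yE -natr1; lra.
rewrite LS; apply: le_trans (ler_wpM2r (expR_ge0 _) (IH (ltnW dm))) _.
rewrite -[leLHS]mulrA ler_wpM2l ?binomial_weight_ge0 // -expRD ler_expR.
have T0' : 0 < T%:R :> R by rewrite ltr0n.
have -> : (y T L + 1) / (p * T%:R) = - (- 2 * (y T L + 1) / (2 * p * T%:R)).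
  by field; rewrite !gt_eqF.
rewrite -opprD lerN2 -mulrDl ler_pM2r ?invr_gt0 ?mulr_gt0 // yE -natr1; lra.
Qed.

Lemma weight_gauss_le T L : (0 < T)%N ->
  w T L <= w T (mode T) * (expR (12 / (4 * p * q)) *
    expR (- (p * q / 2 * (y T L ^+ 2 / (2 * p * q * T%:R))))).
Proof.
move=> T0; have T1 : 1 <= T%:R :> R by rewrite ler1n.
have T0' : 0 < T%:R :> R by rewrite ltr0n.
have /andP[] := mode_itv T; set Y := y T (mode T) => ym0 ym1.
have wm := binomial_weight_ge0 T (mode T).
have q1 : q <= 1 by rewrite gerBl ltW.
have -> : p * q / 2 * (y T L ^+ 2 / (2 * p * q * T%:R)) = y T L ^+ 2 / (4 * T%:R).
  by field; rewrite !gt_eqF.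
(* To be used with [r = q] on the right and [r = p] on the left, [e] being the quadratic in [d].
   Half of [y^2] is given up so that the constant [12 / 2] covers the linear terms, by completing a
   square. *)
have key (r e : R) : 0 < r -> r <= 1 -> p * q <= r -> y T L ^+ 2 / 2 - 12 / 2 <= e ->
    - (e / (2 * r * T%:R)) <= 12 / (4 * p * q) - y T L ^+ 2 / (4 * T%:R).
  move=> r0 r1 pqr he.
  have h1 : y T L ^+ 2 / (4 * T%:R) <= y T L ^+ 2 / 2 / (2 * r * T%:R).
    have -> : y T L ^+ 2 / 2 / (2 * r * T%:R) = y T L ^+ 2 / (4 * T%:R) * r^-1.
      by field; rewrite !gt_eqF.
    by rewrite ler_peMr ?divr_ge0 ?sqr_ge0 ?mulr_ge0 ?invf_ge1 // ltW.
  have h2 : 12 / 2 / (2 * r * T%:R) <= 12 / (4 * p * q).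
    rewrite -mulrA -invfM ler_wpM2l // lef_pV2 ?posrE ?mulr_gt0 //.
    have : p * q <= r * T%:R by nra.
    by lra.
  have h3 : (y T L ^+ 2 / 2 - 12 / 2) / (2 * r * T%:R) <= e / (2 * r * T%:R).
    by rewrite ler_pM2r // invr_gt0 !mulr_gt0.
  by move: h3; rewrite mulrBl; lra.
case: (leqP (mode T) L) => mL.
  have := weight_right (L - mode T) T0; rewrite subnKC //.
  move=> H; apply: (le_trans H); rewrite ler_wpM2l // -expRD ler_expR.
  apply: key => //; first by rewrite ler_piMl // ltW.
  have : y T L = Y + (L - mode T)%:R by rewrite /Y /y natrB //; ring.
  have : 0 <= (L - mode T)%:R :> R by [].
  move: (L - mode T)%:R => d d0 ->.
  have YY : Y ^+ 2 <= 1 by rewrite expr2; nra.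
  have Yd : Y * d <= 0 by rewrite mulr_le0_ge0.
  by have := sqr_ge0 (d - 3); rewrite sqrrB sqrrD; lra.
have := weight_left T0 (leq_subr L (mode T)); rewrite subKn; last exact: ltnW.
move=> H; apply: (le_trans H); rewrite ler_wpM2l // -expRD ler_expR.
apply: key => //; [exact: ltW|by rewrite ler_piMr // ltW|].
have : y T L = Y - (mode T - L)%:R by rewrite /Y /y (natrB _ (ltnW mL)); ring.
have : 0 <= (mode T - L)%:R :> R by [].
move: (mode T - L)%:R => d d0 ->.
have YY : Y ^+ 2 <= 1 by rewrite expr2; nra.
have Yd : 0 <= (1 + Y) * d by rewrite mulr_ge0 // -lerBlDl sub0r ltW.
have Hd : 0 <= d ^+ 2 - 4 * d + 4.
  have -> : d ^+ 2 - 4 * d + 4 = (d - 2) ^+ 2 by ring.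
  exact: sqr_ge0.
have -> : (Y - d) ^+ 2 = Y ^+ 2 - 2 * (Y * d) + d ^+ 2 by ring.
by move: Yd; rewrite mulrDl mul1r; lra.
Qed.

(** A converse to [1 + b <= e^b] with quadratic loss; it rests on [(1 + b) (1 - b + 2 b^2) >= 1]. *)
Lemma expR_le_1D (b : R) : - (1 / 2) <= b -> expR (b - 2 * b ^+ 2) <= 1 + b.
Proof.
move=> hb; have h := expR_ge1Dx (- (b - 2 * b ^+ 2)).
have d0 : 0 < 1 - (b - 2 * b ^+ 2).
  by have := sqr_ge0 (2 * b - 1 / 2); rewrite sqrrB exprMn; lra.
have -> : expR (b - 2 * b ^+ 2) = (expR (- (b - 2 * b ^+ 2)))^-1.
  by rewrite -expRN opprK.
apply: (@le_trans _ _ (1 - (b - 2 * b ^+ 2))^-1).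
  by rewrite lef_pV2 // posrE expR_gt0.
rewrite -[_^-1]mul1r ler_pdivrMr //.
have -> : (1 + b) * (1 - (b - 2 * b ^+ 2)) = 1 + b ^+ 2 * (1 + 2 * b) by ring.
by rewrite lerDl mulr_ge0 ?sqr_ge0 //; lra.
Qed.

End BinomialWeight.

(** * Comparison of binomial weights with a Gaussian profile *)

Section LocalLimit.
Variables (R : realType) (p : R).
Hypotheses (p0 : 0 < p) (p1 : p < 1).
Let q : R := 1 - p.
Let w T L := binomial_weight p q T L.
Let y T L : R := L%:R - p * T%:R.

Let q0 : 0 < q. Proof. by rewrite subr_gt0. Qed.
Let q1 : q <= 1. Proof. by rewrite gerBl ltW. Qed.

(* The weight divided by its Gaussian profile: nearly constant for |L - p T| = O(sqrt T). *)
Let Gam T L := w T L * expR (y T L ^+ 2 / (2 * p * q * T%:R)).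

(** [T] times the error of one step: the first term comes from the Gaussian exponent, the second
    from the quadratic loss in [expR_le_1D]. *)
Let Cst (B : R) := (2 * p * q)^-1 + 2 * B ^+ 2 / (p * q) ^+ 2.

(** The weights have quotient [(1 - a) / (1 + b)], and the Gaussian exponent grows by [a + b] up to
    [(1 - 2 q) / (2 p q T)]. The first orders cancel and an error of order [1 / T] is left. *)
Lemma gam_step T L B : (0 < T)%N -> 0 <= B ->
  B * Num.sqrt T%:R <= p * q * T%:R / 2 ->
  `|y T L| <= B * Num.sqrt T%:R -> `|y T L.+1| <= B * Num.sqrt T%:R ->
  Gam T L.+1 <= Gam T L * expR (Cst B / T%:R) /\
  Gam T L <= Gam T L.+1 * expR (Cst B / T%:R).
Proof.
move=> T0 B0 BT yL yL1; have T0' : 0 < T%:R :> R by rewrite ltr0n.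
have S2 : Num.sqrt T%:R ^+ 2 = T%:R :> R by rewrite sqr_sqrtr ?ler0n.
have pqp : p * q <= p by rewrite ler_piMr // ltW.
have pqq : p * q <= q by rewrite ler_piMl // ltW.
have pq0 : 0 < p * q by rewrite mulr_gt0.
have yS : y T L.+1 = y T L + 1 by rewrite /y -natr1; ring.
have bnd (r z : R) : 0 < r -> p * q <= r -> `|z| <= B * Num.sqrt T%:R ->
    `|z / (r * T%:R)| <= 1 / 2 /\
    2 * (z / (r * T%:R)) ^+ 2 <= 2 * B ^+ 2 / (p * q) ^+ 2 / T%:R.
  move=> r0 pqr zB; have rT : 0 < r * T%:R by rewrite mulr_gt0.
  split.
    rewrite normrM normfV (gtr0_norm rT) ler_pdivrMr //.
    apply: (le_trans zB); apply: (le_trans BT).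
    have : p * q * T%:R <= r * T%:R by rewrite ler_pM2r.
    by lra.
  have -> : 2 * B ^+ 2 / (p * q) ^+ 2 / T%:R =
      2 * (B ^+ 2 * T%:R / ((p * q) ^+ 2 * T%:R ^+ 2)) by field; rewrite !gt_eqF.
  rewrite ler_wpM2l // expr_div_n exprMn.
  have z2 : z ^+ 2 <= B ^+ 2 * T%:R.
    by rewrite -S2 -exprMn -(real_normK (num_real z)) lerXn2r ?nnegrE // mulr_ge0 ?sqrtr_ge0.
  apply: ler_pM; [exact: sqr_ge0|by rewrite invr_ge0 mulr_ge0 ?sqr_ge0|exact: z2|].
  rewrite lef_pV2 ?posrE ?mulr_gt0 ?exprn_gt0 // ler_pM2r ?exprn_gt0 //.
  by rewrite lerXn2r ?nnegrE // ltW.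
set a := y T L / (q * T%:R); set b := y T L.+1 / (p * T%:R).
have [ha ha2] := bnd _ _ q0 pqq yL; have [hb hb2] := bnd _ _ p0 pqp yL1.
rewrite -/a -/b in ha ha2 hb hb2.
have E : w T L.+1 * (1 + b) = w T L * (1 - a).
  have pqT : p * q * T%:R != 0 by rewrite !mulf_neq0 // gt_eqF.
  apply: (mulIf pqT); have := binomial_weight_rec p T L; rewrite -/q -/(w _ _).
  have -> : q * (p * T%:R + (L%:R - p * T%:R) + 1) = (1 + b) * (p * q * T%:R).
    by rewrite /b yS /y; field; rewrite !gt_eqF.
  have -> : p * (q * T%:R - (L%:R - p * T%:R)) = (1 - a) * (p * q * T%:R).
    by rewrite /a /y; field; rewrite !gt_eqF.
  by rewrite -!mulrA => ->.
have W : 0 <= w T L by exact: binomial_weight_ge0.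
have W1 : 0 <= w T L.+1 by exact: binomial_weight_ge0.
set e0 := y T L ^+ 2 / (2 * p * q * T%:R).
set e1 := y T L.+1 ^+ 2 / (2 * p * q * T%:R).
have d1 : `|e1 - e0 - a - b| <= (2 * p * q)^-1 / T%:R.
  have -> : e1 - e0 - a - b = (1 - 2 * q) * ((2 * p * q)^-1 / T%:R).
    by rewrite /e1 /e0 /a /b yS /q; field; rewrite !gt_eqF ?subr_gt0.
  have h : 0 <= (2 * p * q)^-1 / T%:R by rewrite divr_ge0 ?invr_ge0 ?mulr_ge0 // ltW.
  rewrite normrM (ger0_norm h) ler_piMl // ler_norml; move: (q0) (q1); lra.
have {}d1 : - ((2 * p * q)^-1 / T%:R) <= e1 - e0 - a - b <= (2 * p * q)^-1 / T%:R.
  by rewrite -ler_norml.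
have CT : Cst B / T%:R = (2 * p * q)^-1 / T%:R + 2 * B ^+ 2 / (p * q) ^+ 2 / T%:R.
  by rewrite /Cst mulrDl.
set c := Cst B / T%:R in CT *; rewrite /Gam -/e0 -/e1; move: E W W1.
move: (w T L) (w T L.+1) => u u' E W W1; split.
  have h1 : u' * expR (b - 2 * b ^+ 2) <= u * expR (- a).
    apply: (@le_trans _ _ (u' * (1 + b))).
      apply: ler_wpM2l => //; apply: expR_le_1D; move: hb; by rewrite ler_norml => /andP[].
    by rewrite E ler_wpM2l // ler_1B_expRN.
  have -> : u * expR e0 * expR c = u * expR (e0 + c) by rewrite expRD mulrA.
  have -> : expR e1 = expR (b - 2 * b ^+ 2) * expR (e1 - b + 2 * b ^+ 2).
    by rewrite -expRD; congr expR; ring.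
  rewrite mulrA; apply: le_trans (ler_wpM2r (expR_ge0 _) h1) _.
  rewrite -[leLHS]mulrA -expRD ler_wpM2l // ler_expR.
  by rewrite CT; case/andP: d1 => _; move: hb2; lra.
have h1 : u * expR (- a - 2 * a ^+ 2) <= u' * expR b.
  apply: (@le_trans _ _ (u * (1 - a))).
    rewrite -(sqrrN a); apply: ler_wpM2l => //; apply: expR_le_1D.
    by move: ha; rewrite ler_norml => /andP[_]; lra.
  by rewrite -E ler_wpM2l // expR_ge1Dx.
have -> : u' * expR e1 * expR c = u' * expR (e1 + c) by rewrite expRD mulrA.
have -> : expR e0 = expR (- a - 2 * a ^+ 2) * expR (e0 + a + 2 * a ^+ 2).
  by rewrite -expRD; congr expR; ring.
rewrite mulrA; apply: le_trans (ler_wpM2r (expR_ge0 _) h1) _.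
rewrite -[leLHS]mulrA -expRD ler_wpM2l // ler_expR.
by rewrite CT; case/andP: d1 => + _; move: ha2; lra.
Qed.

Lemma gam_chain T L d B : (0 < T)%N -> 0 <= B ->
  B * Num.sqrt T%:R <= p * q * T%:R / 2 ->
  `|y T L| <= B * Num.sqrt T%:R -> `|y T (L + d)| <= B * Num.sqrt T%:R ->
  Gam T (L + d) <= Gam T L * expR (d%:R * (Cst B / T%:R)) /\
  Gam T L <= Gam T (L + d) * expR (d%:R * (Cst B / T%:R)).
Proof.
move=> T0 B0 BT yL; elim: d => [|d IH]; first by rewrite addn0 mul0r expR0 !mulr1.
have yE (d' : nat) : y T (L + d') = y T L + d'%:R by rewrite /y natrD; ring.
move=> yd1; have yd : `|y T (L + d)| <= B * Num.sqrt T%:R.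
  move: yL yd1; rewrite !ler_norml !yE -natr1.
  have : 0 <= d%:R :> R by [].
  by lra.
have [IH1 IH2] := IH yd; rewrite addnS in yd1 *.
have [S1 S2] := gam_step T0 B0 BT yd yd1.
rewrite -natr1 mulrDl mul1r; split.
  apply: (le_trans S1); rewrite expRD [leRHS]mulrA ler_wpM2r // expR_ge0.
apply: (le_trans IH2); rewrite [_ + Cst _ / _]addrC expRD [leRHS]mulrA ler_wpM2r ?expR_ge0 //.
Qed.

(** At most [2 B sqrt T] steps separate [L] and [M], each costing [Cst B / T] in the exponent. *)
Lemma gam_compare T L M B : (0 < T)%N -> 0 <= B ->
  B * Num.sqrt T%:R <= p * q * T%:R / 2 ->
  `|y T L| <= B * Num.sqrt T%:R -> `|y T M| <= B * Num.sqrt T%:R ->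
  Gam T L <= Gam T M * expR (2 * B * Cst B / Num.sqrt T%:R).
Proof.
move=> T0 B0 BT yL yM.
have T0' : 0 < T%:R :> R by rewrite ltr0n.
have S0 : 0 < Num.sqrt T%:R :> R by rewrite sqrtr_gt0.
have C0 : 0 <= Cst B by rewrite addr_ge0 ?invr_ge0 ?divr_ge0 ?mulr_ge0 ?sqr_ge0 // ltW.
have G0 K : 0 <= Gam T K by rewrite mulr_ge0 ?expR_ge0 //; exact: binomial_weight_ge0.
have dS (d : R) : d <= 2 * B * Num.sqrt T%:R ->
    d * (Cst B / T%:R) <= 2 * B * Cst B / Num.sqrt T%:R.
  move=> dB; apply: (@le_trans _ _ (2 * B * Num.sqrt T%:R * (Cst B / T%:R))).
    by rewrite ler_wpM2r // divr_ge0 // ltW.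
  rewrite -[X in Cst B / X](@sqr_sqrtr _ T%:R) ?ler0n //.
  by rewrite le_eqVlt; apply/orP; left; apply/eqP; field; rewrite gt_eqF.
case: (leqP L M) => LM.
  have yML : `|y T (L + (M - L))| <= B * Num.sqrt T%:R by rewrite subnKC.
  have [_ H] := gam_chain T0 B0 BT yL yML; rewrite subnKC // in H.
  apply: (le_trans H); rewrite ler_wpM2l // ler_expR dS // natrB //.
  by move: yL yM; rewrite !ler_norml /y; lra.
have yML : `|y T (M + (L - M))| <= B * Num.sqrt T%:R by rewrite subnKC // ltnW.
have [H _] := gam_chain T0 B0 BT yM yML; rewrite subnKC ?(ltnW LM) // in H.
apply: (le_trans H); rewrite ler_wpM2l // ler_expR dS // natrB ?(ltnW LM) //.
by move: yL yM; rewrite !ler_norml /y; lra.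
Qed.

(** [gam_compare] with the reference index, in both directions. The extra term [(2 p q T)^-1] bounds
    the Gaussian exponent at [mode p T], whose deviation from the mean is below 1. *)
Lemma weight_ratio_itv B : 1 <= B -> exists kappa : R, forall T L, (0 < T)%N ->
  B * Num.sqrt T%:R <= p * q * T%:R / 2 ->
  `|L%:R - p * T%:R| <= B * Num.sqrt T%:R ->
  expR (- (kappa / Num.sqrt T%:R) - (L%:R - p * T%:R) ^+ 2 / (2 * p * q * T%:R))
    <= binomial_weight p q T L / binomial_weight p q T (mode p T)
    <= expR ((2 * p * q * T%:R)^-1 + kappa / Num.sqrt T%:R
             - (L%:R - p * T%:R) ^+ 2 / (2 * p * q * T%:R)).
Proof.
move=> B1; have B0 : 0 <= B by exact: le_trans B1.
exists (2 * B * Cst B) => T L T0 BT yL.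
have T0' : 0 < T%:R :> R by rewrite ltr0n.
have S1 : 1 <= Num.sqrt T%:R :> R by rewrite -[leLHS]sqrtr1 ler_sqrt ?ler1n.
have /andP[ym0 ym1] := mode_itv p0 T; rewrite -/(y T (mode p T)) in ym0 ym1.
have yM : `|y T (mode p T)| <= B * Num.sqrt T%:R.
  apply: (@le_trans _ _ 1); last by rewrite -[leLHS]mul1r ler_pM.
  by rewrite ler_norml ltW // (le_trans ym1).
have wm : 0 < w T (mode p T) by apply: binomial_weight_gt0 => //; exact: mode_le.
have := gam_compare T0 B0 BT yL yM; have := gam_compare T0 B0 BT yM yL.
rewrite /Gam -/(y T L) -/(w T L) -/(w T (mode p T)).
set c := 2 * B * Cst B / Num.sqrt T%:R.
set e1 := y T L ^+ 2 / _; set e0 := y T (mode p T) ^+ 2 / _.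
move: wm; move: (w T L) (w T (mode p T)) => u' u u0 h1 h2.
have pqT : 0 < 2 * p * q * T%:R by rewrite !mulr_gt0.
have e00 : 0 <= e0 by rewrite divr_ge0 ?sqr_ge0 // ltW.
have e01 : e0 <= (2 * p * q * T%:R)^-1.
  by rewrite -[leRHS]mul1r ler_wpM2r ?invr_ge0 ?(ltW pqT) // expr2; nra.
rewrite ler_pdivlMr // ler_pdivrMr //; apply/andP; split.
  have -> : expR (- c - e1) * u = u * expR e0 * (expR (- c - e1 - e0)).
    by rewrite -mulrA -expRD [expR _ * u]mulrC; congr (_ * expR _); ring.
  apply: le_trans (ler_wpM2r (expR_ge0 _) h1) _.
  have -> : u' * expR e1 * expR c * expR (- c - e1 - e0) = u' * expR (- e0).
    by rewrite -!mulrA -!expRD; congr (_ * expR _); ring.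
  have u'0 : 0 <= u'.
    rewrite -(@pmulr_lge0 _ (expR e1 * expR c)) ?mulr_gt0 ?expR_gt0 // mulrA.
    by apply: le_trans h1; rewrite mulr_ge0 ?expR_ge0 // ltW.
  by rewrite ler_piMr // -expR0 ler_expR oppr_le0.
have -> : u' = u' * expR e1 * expR (- e1) by rewrite -mulrA -expRD subrr expR0 mulr1.
apply: le_trans (ler_wpM2r (expR_ge0 _) h2) _.
have -> : u * expR e0 * expR c * expR (- e1) = u * expR (e0 + c - e1).
  by rewrite -!mulrA -!expRD; congr (_ * expR _); ring.
rewrite mulrC ler_wpM2r ?(ltW u0) // ler_expR; lra.
Qed.

End LocalLimit.

(** * Convergence of the truncated moments *)

Section MomentLimit.
Variables (R : realType) (p : R).
Hypotheses (p0 : 0 < p) (p1 : p < 1).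
Let q : R := 1 - p.
Let mu := @lebesgue_measure R.
Let q0 : 0 < q. Proof. by rewrite subr_gt0. Qed.
Let q1 : q <= 1. Proof. by rewrite gerBl ltW. Qed.

(** The factor 2 makes the limiting profile [exp(- u^2)], the weight of the Hermite polynomials. *)
Definition node_scale T : R := Num.sqrt (2 * p * (1 - p) * T%:R).
Definition node T L : R := (L%:R - p * T%:R) / node_scale T.
Definition rel_weight T L : R :=
  binomial_weight p (1 - p) T L / binomial_weight p (1 - p) T (mode p T).
Definition site T u := Num.truncn (node_scale T * u + p * T%:R).

Lemma node_scale_gt0 T : (0 < T)%N -> 0 < node_scale T.
Proof. by move=> T0; rewrite sqrtr_gt0 !mulr_gt0 ?ltr0n. Qed.

Lemma node_scaleE T :
  node_scale T = Num.sqrt (2 * p * q) * Num.sqrt T%:R.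
Proof. by rewrite /node_scale -/q sqrtrM // !mulr_ge0 // ltW. Qed.

Lemma node_scale_le T : node_scale T <= Num.sqrt T%:R.
Proof.
rewrite node_scaleE -[leRHS]mul1r ler_wpM2r ?sqrtr_ge0 //.
rewrite -[leRHS]sqrtr1 ler_sqrt //.
have := sqr_ge0 (2 * p - 1); rewrite /q sqrrB exprMn; lra.
Qed.

Lemma node_sqr T L : (0 < T)%N ->
  node T L ^+ 2 = (L%:R - p * T%:R) ^+ 2 / (2 * p * q * T%:R).
Proof.
move=> T0; rewrite /node expr_div_n sqr_sqrtr // !mulr_ge0 //; exact: ltW.
Qed.

Lemma nodeS T L : (0 < T)%N -> node T L.+1 = node T L + (node_scale T)^-1.
Proof. by move=> T0; rewrite /node -natr1 addrAC mulrDl mul1r. Qed.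

Lemma site_itv T u : (0 < T)%N -> 0 <= node_scale T * u + p * T%:R ->
  node T (site T u) <= u < node T (site T u).+1.
Proof.
move=> T0 /truncn_itv; rewrite -/(site T u) => /andP[h1 h2].
have t0 := node_scale_gt0 T0.
rewrite /node ler_pdivrMr // ltr_pdivlMr // [u * _]mulrC; lra.
Qed.

Lemma near_sqrt_ge (a : R) : \forall T \near \oo, a <= Num.sqrt T%:R.
Proof.
exists (Num.truncn (a ^+ 2)).+1 => // T /= aT.
have h : a ^+ 2 <= T%:R.
  by rewrite (le_trans (ltW (truncnS_gt _))) // ler_nat.
apply: (le_trans (ler_norm a)); rewrite -sqrtr_sqr ler_sqrt ?ler0n //.
Qed.

Lemma cvg_sqrtV : (Num.sqrt T%:R)^-1 @[T --> \oo] --> (0 : R).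
Proof.
apply/cvgr0Pnorm_le => e e0; near=> T.
have h : e^-1 <= Num.sqrt T%:R by near: T; exact: near_sqrt_ge.
have S0 : 0 < Num.sqrt T%:R :> R by apply: lt_le_trans h; rewrite invr_gt0.
by rewrite ger0_norm ?invr_ge0 ?sqrtr_ge0 // -[e]invrK lef_pV2 ?posrE ?invr_gt0.
Unshelve. all: by end_near.
Qed.

Lemma near_site_ge0 u : \forall T \near \oo, 0 <= node_scale T * u + p * T%:R.
Proof.
near=> T.
have h : `|u| / p <= Num.sqrt T%:R by near: T; exact: near_sqrt_ge.
have S0 : 0 <= Num.sqrt T%:R :> R by exact: sqrtr_ge0.
have uS : `|u| <= p * Num.sqrt T%:R by rewrite mulrC -ler_pdivrMr.
have S2 : T%:R = Num.sqrt T%:R ^+ 2 :> R by rewrite sqr_sqrtr ?ler0n.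
have h1 : - (node_scale T * u) <= Num.sqrt T%:R * `|u|.
  apply: (le_trans (ler_norm _)); rewrite normrN normrM ler_wpM2r //.
  by rewrite ger0_norm ?sqrtr_ge0 // node_scale_le.
have h2 : Num.sqrt T%:R * `|u| <= p * T%:R.
  by rewrite [in leRHS]S2 expr2 mulrA [p * _]mulrC -[leRHS]mulrA ler_wpM2l.
lra.
Unshelve. all: by end_near.
Qed.

Lemma cvg_node_site u : node T (site T u) @[T --> \oo] --> u.
Proof.
rewrite -subr_cvg0; apply: norm_cvg0.
have cV : ((Num.sqrt (2 * p * q))^-1 * (Num.sqrt T%:R)^-1) @[T --> \oo] --> (0 : R).
  rewrite -(mulr0 (Num.sqrt (2 * p * q))^-1).
  by apply: cvgM; [exact: cvg_cst|exact: cvg_sqrtV].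
apply: squeeze_cvgr (cvg_cst 0) cV; near=> T.
have T0 : (0 < T)%N by near: T; exact: nbhs_infty_gt.
have h : 0 <= node_scale T * u + p * T%:R by near: T; exact: near_site_ge0.
have := site_itv T0 h; rewrite nodeS // -invfM -node_scaleE => /andP[h1 h2].
rewrite normr_ge0 /= ler_norml; have := node_scale_gt0 T0.
rewrite -invr_gt0; lra.
Unshelve. all: by end_near.
Qed.

Lemma cvg_rel_weight u : rel_weight T (site T u) @[T --> \oo] --> gauss_fun u.
Proof.
(* The added 1 absorbs the rounding in [site], which is at most one unit and hence at most
   [sqrt T]. *)
pose B := `|u| + 1; have B1 : 1 <= B by rewrite lerDr.
have [kappa Hk] := weight_ratio_itv p0 p1 B1.
have sV := cvg_sqrtV.
have cn2 : node T (site T u) ^+ 2 @[T --> \oo] --> u ^+ 2.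
  by rewrite !expr2; apply: cvgM; exact: cvg_node_site.
have ckS : kappa / Num.sqrt T%:R @[T --> \oo] --> 0.
  by rewrite -(mulr0 kappa); apply: cvgM => //; exact: cvg_cst.
have cT : (2 * p * q)^-1 * ((Num.sqrt T%:R)^-1 * (Num.sqrt T%:R)^-1) @[T --> \oo] --> 0.
  rewrite -(mulr0 (2 * p * q)^-1) -[in X in _ --> X](mulr0 0).
  by apply: cvgM; [exact: cvg_cst|exact: cvgM].
have cl : expR (- (kappa / Num.sqrt T%:R) - node T (site T u) ^+ 2) @[T --> \oo]
    --> gauss_fun u.
  rewrite /gauss_fun -[- u ^+ 2]add0r -[X in X - u ^+ 2]oppr0.
  apply: (cvg_comp _ expR); last exact: continuous_expR.
  by apply: cvgB => //; exact: cvgN.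
have cu : expR ((2 * p * q)^-1 * ((Num.sqrt T%:R)^-1 * (Num.sqrt T%:R)^-1) +
    kappa / Num.sqrt T%:R - node T (site T u) ^+ 2) @[T --> \oo] --> gauss_fun u.
  rewrite /gauss_fun -[- u ^+ 2]add0r -[X in X - u ^+ 2](addr0 0).
  apply: (cvg_comp _ expR); last exact: continuous_expR.
  by apply: cvgB => //; exact: cvgD.
apply: squeeze_cvgr cl cu; near=> T.
have T0 : (0 < T)%N by near: T; exact: nbhs_infty_gt.
have h : 0 <= node_scale T * u + p * T%:R by near: T; exact: near_site_ge0.
have h2 : 2 * B / (p * q) <= Num.sqrt T%:R by near: T; exact: near_sqrt_ge.
have S2 : T%:R = Num.sqrt T%:R ^+ 2 :> R by rewrite sqr_sqrtr ?ler0n.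
have T0' : 0 < T%:R :> R by rewrite ltr0n.
have S0 : 0 < Num.sqrt T%:R :> R by rewrite sqrtr_gt0.
have S1 : 1 <= Num.sqrt T%:R :> R by rewrite -[leLHS]sqrtr1 ler_sqrt ?ler1n.
have pq0 : 0 < p * q by rewrite mulr_gt0.
have := Hk T (site T u) T0; rewrite -/q -node_sqr //.
have -> : (2 * p * q * T%:R)^-1 =
    (2 * p * q)^-1 * ((Num.sqrt T%:R)^-1 * (Num.sqrt T%:R)^-1) :> R.
  by rewrite [in LHS]S2 expr2 !invfM.
apply.
  rewrite [in leRHS]S2 expr2 mulrA [leRHS]mulrAC ler_wpM2r ?(ltW S0) //.
  by move: h2; rewrite ler_pdivrMr //; lra.
have := truncn_itv h; rewrite -/(site T u) -natr1 => /andP[h3 h4].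
have tu : `|node_scale T * u| <= `|u| * Num.sqrt T%:R.
  rewrite normrM mulrC ler_wpM2l // ger0_norm ?sqrtr_ge0 //; exact: node_scale_le.
move: tu; rewrite /B mulrDl mul1r !ler_norml => /andP[h5 h6].
by apply/andP; split; lra.
Unshelve. all: by end_near.
Qed.

End MomentLimit.

(** * Moments as integrals of step functions, and dominated convergence *)

Section StepFunction.
Variables (R : realType) (p : R).
Hypotheses (p0 : 0 < p) (p1 : p < 1).
Let q : R := 1 - p.
Let mu := @lebesgue_measure R.
Let q0 : 0 < q. Proof. by rewrite subr_gt0. Qed.
Let q1 : q <= 1. Proof. by rewrite gerBl ltW. Qed.

Definition cell T L : set R := `[node p T L, node p T L.+1[%classic.

Definition step_moment k (N : nat -> nat) T (u : R) : R :=
  \sum_(L < N T) rel_weight p T L * node p T L ^+ k * \1_(cell T L) u.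

Lemma cellP T L u : (0 < T)%N ->
  (u \in cell T L) = (0 <= node_scale p T * u + p * T%:R) && (site p T u == L).
Proof.
move=> T0; have t0 := node_scale_gt0 p0 p1 T0.
have -> : (u \in cell T L) =
    (L%:R <= node_scale p T * u + p * T%:R < L.+1%:R).
  rewrite /cell mem_setE in_itv /= /node ler_pdivrMr // ltr_pdivlMr //.
  by rewrite lerBlDr ltrBrDr mulrC.
case: (boolP (0 <= _)) => [h|h] /=; first by rewrite /site truncn_eq.
by apply/negP => /andP[h1 _]; case/negP: h; exact: le_trans h1.
Qed.

Lemma step_momentE k N T u : (0 < T)%N ->
  step_moment k N T u =
  if (0 <= node_scale p T * u + p * T%:R) && (site p T u < N T)%N
  then rel_weight p T (site p T u) * node p T (site p T u) ^+ k else 0.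
Proof.
move=> T0; rewrite /step_moment; under eq_bigr => L _ do rewrite indicE cellP //.
case: (boolP (0 <= _)) => h /=; last by rewrite big1 // => L _; rewrite mulr0.
case: ltnP => sN; last first.
  rewrite big1 // => L _; rewrite gtn_eqF ?mulr0 //.
  exact: leq_trans (ltn_ord L) sN.
rewrite (bigD1 (Ordinal sN)) //= eqxx mulr1 big1 ?addr0 // => L /negPf.
by rewrite -val_eqE /= eq_sym => ->; rewrite mulr0.
Qed.

Lemma integrable_indic_cell T L : mu.-integrable setT (EFin \o \1_(cell T L)).
Proof. exact: integrable_indic_itv. Qed.

Lemma integrable_step_moment k N T :
  mu.-integrable setT (EFin \o step_moment k N T).
Proof.
apply: (@integrable_sumR _ _ measurableT 'I_(N T) (fun L u =>
  rel_weight p T L * node p T L ^+ k * \1_(cell T L) u)) => L.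
by apply: integrableZlR => //; exact: integrable_indic_cell.
Qed.

Lemma Rintegral_step_moment k N T : (0 < T)%N ->
  \int[mu]_(u in setT) step_moment k N T u =
  (\sum_(L < N T) rel_weight p T L * node p T L ^+ k) / node_scale p T.
Proof.
move=> T0; rewrite /step_moment Rintegral_sumR //; last first.
  by move=> L; apply: integrableZlR => //; exact: integrable_indic_cell.
rewrite mulr_suml; apply: eq_bigr => L _; rewrite RintegralZl //; last first.
  exact: integrable_indic_cell.
congr (_ * _); rewrite /Rintegral integral_indic //; last exact: measurable_itv.
transitivity (fine (lebesgue_measure (`[node p T L, node p T L.+1[%classic : set R))).
  by rewrite setIT.
rewrite lebesgue_measure_itv /= lte_fin nodeS //.
have t0 := node_scale_gt0 p0 p1 T0.
by rewrite ltrDl invr_gt0 t0 -EFinB /= addrAC subrr add0r.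
Qed.

Lemma step_moment_le k : exists2 C : R, 0 <= C & forall N T u, (0 < T)%N ->
  `|step_moment k N T u| <= C * (oneDsqr u)^-1.
Proof.
have c0 : 0 < p * q / 2 by rewrite divr_gt0 // mulr_gt0.
have [C C0 HC] := normX_expR_le k c0.
pose K := expR (12 / (4 * p * q)); pose b2 := (2 * p * q)^-1.
have b20 : 0 < b2 by rewrite invr_gt0 !mulr_gt0.
(* The weight is bounded at the node [v], not at [u]. Cells have squared length at most [b2], so
   [u^2 <= 2 v^2 + 2 b2]; the last factor passes from [1 + v^2] to [1 + u^2]. *)
exists (K * C * (2 + 2 * b2)).
  by rewrite !mulr_ge0 ?expR_ge0 // addr_ge0 // mulr_ge0 // ltW.
move=> N T u T0; have o0 : 0 < oneDsqr u by exact: lt_le_trans ltr01 (oneDsqr_ge1 u).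
rewrite step_momentE //; case: ifP => [/andP[h _]|_]; last first.
  rewrite normr0 !mulr_ge0 ?expR_ge0 // ?invr_ge0 ?(ltW o0) //.
  by rewrite addr_ge0 // mulr_ge0 // ltW.
set L := site p T u; set v := node p T L.
have wm : 0 < binomial_weight p q T (mode p T).
  by apply: binomial_weight_gt0 => //; exact: mode_le.
have W0 : 0 <= rel_weight p T L.
  by rewrite divr_ge0 //; apply: binomial_weight_ge0.
have W1 : rel_weight p T L <= K * expR (- (p * q / 2 * v ^+ 2)).
  rewrite /rel_weight ler_pdivrMr // mulrC /v node_sqr //.
  exact: weight_gauss_le.
rewrite normrM normrX (ger0_norm W0).
apply: (@le_trans _ _ (K * (C * (oneDsqr v)^-1))).
  apply: (@le_trans _ _ (K * expR (- (p * q / 2 * v ^+ 2)) * `|v| ^+ k)).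
    by rewrite ler_wpM2r ?exprn_ge0.
  by rewrite -mulrA ler_wpM2l ?expR_ge0 // mulrC; exact: HC.
rewrite -!mulrA !ler_wpM2l ?expR_ge0 //.
have ov : 0 < oneDsqr v by exact: lt_le_trans ltr01 (oneDsqr_ge1 v).
rewrite ler_pdivlMr // mulrC ler_pdivrMr //.
have := site_itv p0 p1 T0 h; rewrite nodeS // -/L -/v => /andP[h1 h2].
set t := (node_scale p T)^-1 in h2.
have t0 : 0 < t by rewrite invr_gt0; exact: node_scale_gt0.
have t2 : t ^+ 2 <= b2.
  rewrite exprVn sqr_sqrtr; last by rewrite !mulr_ge0 // ltW.
  have h0 : 0 < 2 * p * q by rewrite !mulr_gt0.
  rewrite -/q lef_pV2 ?posrE ?(mulr_gt0 h0) ?ltr0n //.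
  by rewrite ler_peMr ?ler1n // ltW.
have uv2 : (u - v) ^+ 2 <= b2.
  apply: (le_trans _ t2); rewrite lerXn2r ?nnegrE ?subr_ge0 ?(ltW t0) //.
  by rewrite lerBlDl ltW.
have u2 : u ^+ 2 <= 2 * v ^+ 2 + 2 * b2.
  have H0 : u ^+ 2 = 2 * v ^+ 2 + 2 * (u - v) ^+ 2 - (u - 2 * v) ^+ 2 by ring.
  by have := sqr_ge0 (u - 2 * v); rewrite H0; lra.
rewrite /oneDsqr.
have vb : 0 <= v ^+ 2 * b2 by rewrite mulr_ge0 ?sqr_ge0 // ltW.
have -> : (2 + 2 * b2) * (1 + v ^+ 2) =
  2 + 2 * b2 + 2 * v ^+ 2 + 2 * (v ^+ 2 * b2) by ring.
by lra.
Qed.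

(** Dominated convergence for the step functions. The point [z], where the truncation by [N T] need
    not settle, is a null set. *)
Lemma binomial_moment_cvg k (N : nat -> nat) (D : set R) (z : R) :
  measurable D ->
  (forall u, u != z -> \forall T \near \oo, (site p T u < N T)%N = (u \in D)) ->
  (\sum_(L < N T) rel_weight p T L * node p T L ^+ k) / node_scale p T
    @[T --> \oo] --> gint D 'X^k.
Proof.
(* Skipping [T = 0], where [node_scale] vanishes, makes the majorant valid along the whole
   sequence. *)
move=> mD ND; rewrite -cvg_shiftS.
pose f (t : nat) : R -> \bar R := EFin \o step_moment k N t.+1.
pose g : R -> \bar R := (EFin \o gpoly ('X^k : {poly R})) \_ D.
have mf t : measurable_fun setT (f t).
  exact: (measurable_int mu (integrable_step_moment k N t.+1)).
have mg : measurable_fun setT g.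
  apply: (measurable_restrictT _ mD).1.
  exact: (measurable_int mu (integrable_gpoly _ mD)).
have fg : {ae mu, forall u, setT u -> f ^~ u @ \oo --> g u}.
  exists [set z]; split => //; first exact: lebesgue_measure_set1.
  apply: subsetCl => u /= /eqP uz _.
  have cg : (rel_weight p T (site p T u) * node p T (site p T u) ^+ k
      @[T --> \oo] --> gpoly ('X^k : {poly R}) u).
    rewrite /gpoly hornerXn mulrC; apply: cvgM; first exact: cvg_rel_weight.
    apply: (cvg_comp _ (fun x : R => x ^+ k)); first exact: cvg_node_site.
    exact: exprn_continuous.
  have {}cg : step_moment k N T u @[T --> \oo] -->
      (if u \in D then gpoly ('X^k : {poly R}) u else 0).
    apply: cvg_trans (_ : (if u \in D then rel_weight p T (site p T u) *
      node p T (site p T u) ^+ k else 0) @[T --> \oo] --> _).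
      apply: near_eq_cvg; near=> T.
      have T0 : (0 < T)%N by near: T; exact: nbhs_infty_gt.
      rewrite step_momentE //.
      have -> : 0 <= node_scale p T * u + p * T%:R.
        by near: T; exact: near_site_ge0.
      have -> // : (site p T u < N T)%N = (u \in D).
        by near: T; exact: ND.
    by case: ifP => // _; exact: cvg_cst.
  move: cg; rewrite -cvg_shiftS => cg.
  have -> : g u = (if u \in D then gpoly ('X^k : {poly R}) u else 0)%:E.
    by rewrite /g patchE; case: ifP.
  by apply: cvg_EFin; [exact: nearW|exact: cg].
have [C C0 HC] := step_moment_le k.
pose bd (v : R) : R := C * (oneDsqr v)^-1.
have fle : {ae mu, forall u t, setT u ->
    (`|f t u| <= (EFin \o bd) u)%E}.
  by apply: aeW => u t _; rewrite /f /= lee_fin HC.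
have [_ _ H] := @dominated_convergence _ _ _ mu setT measurableT f g _ mf mg fg
  (integrable_oneDsqrV C0) fle.
move: H => /=; rewrite /g -integral_mkcond.
have fin : (\int[mu]_(x in D) (EFin \o gpoly ('X^k : {poly R})) x)%E \is a fin_num.
  by apply: integrable_fin_num => //; exact: integrable_gpoly.
rewrite -(fineK fin) => /fine_cvg H.
apply: cvg_trans H; apply: near_eq_cvg; near=> t.
by rewrite /= -Rintegral_step_moment.
Unshelve. all: by end_near.
Qed.

End StepFunction.

(** * The limit theorem *)

Section DetLimit.
Variable R : realType.

Lemma cvg_det n (A : nat -> 'M[R]_n) (B : 'M[R]_n) :
  (forall i j, A t i j @[t --> \oo] --> B i j) ->
  \det (A t) @[t --> \oo] --> \det B.
Proof.
move=> AB; rewrite /determinant.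
apply: (cvg_big (op := +%R)) => [|s _]; first exact: add_continuous.
apply: cvgM; first exact: cvg_cst.
by apply: cvg_big => [|i _]; [exact: mul_continuous|exact: AB].
Qed.

End DetLimit.

Section HankelLimit.
Variables (R : realType) (p : R).
Hypotheses (p0 : 0 < p) (p1 : p < 1).

Definition moment_hankel n T N : 'M[R]_n := \matrix_(i, j)
  ((\sum_(L < N) rel_weight p T L * node p T L ^+ (i + j)) / node_scale p T).

(** The scalar pulled out does not depend on the truncation [N], so it disappears from quotients. *)
Lemma hankel_moment_hankel n T N : (0 < T)%N ->
  \det (hankel n (binomial_weight p (1 - p) T)
    (fun l => (l%:R - p * T%:R) / node_scale p T) N) =
  (binomial_weight p (1 - p) T (mode p T) * node_scale p T) ^+ n *
  \det (moment_hankel n T N).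
Proof.
move=> T0; rewrite -detZ; congr (\det _); apply/matrixP => i j; rewrite !mxE.
have t0 : node_scale p T != 0 by rewrite gt_eqF // node_scale_gt0.
have w0 : binomial_weight p (1 - p) T (mode p T) != 0.
  by rewrite gt_eqF //; apply: binomial_weight_gt0 => //; exact: mode_le.
rewrite -[RHS]mulrA [X in _ = _ * X]mulrCA divff // mulr1 mulr_sumr.
apply: eq_bigr => L _.
by rewrite /rel_weight /node; field; rewrite ?t0 ?w0.
Qed.

Lemma nat_threshold (X : R) : exists M : nat, forall n, (n < M)%N = (n%:R < X).
Proof.
have ex : exists n : nat, X <= n%:R.
  exists (Num.truncn X).+1; exact/ltW/truncnS_gt.
exists (ex_minn ex) => n; case: ex_minnP => M XM Mmin.
rewrite ltnNge [RHS]ltNge; congr (~~ _); apply/idP/idP => [Mn|]; last exact: Mmin.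
by rewrite (le_trans XM) // ler_nat.
Qed.

Lemma near_node_scale_ge a : \forall T \near \oo, a <= node_scale p T.
Proof.
have q0 : 0 < 1 - p by rewrite subr_gt0.
have c0 : 0 < Num.sqrt (2 * p * (1 - p)) by rewrite sqrtr_gt0 !mulr_gt0.
near=> T; rewrite node_scaleE // mulrC -ler_pdivrMr //.
by near: T; exact: near_sqrt_ge.
Unshelve. all: by end_near.
Qed.

Lemma site_full u : \forall T \near \oo, (site p T u < T.+1)%N = (u \in [set: R]).
Proof.
have q0 : 0 < 1 - p by rewrite subr_gt0.
have q1 : 1 - p < 1 by rewrite gtrBl.
near=> T; rewrite in_setT /site.
have h : 0 <= node_scale p T * u + p * T%:R by near: T; exact: near_site_ge0.
(* Exchanging successes and failures: nonnegativity for [1 - p] and [- u] is the upper bound by [T]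
   for [p] and [u]. *)
have h' : 0 <= node_scale (1 - p) T * (- u) + (1 - p) * T%:R.
  by near: T; exact: near_site_ge0.
have E : node_scale (1 - p) T = node_scale p T.
  by rewrite /node_scale; congr (Num.sqrt (_ * _)); ring.
rewrite truncn_lt_nat // -natr1; move: h'; rewrite E; lra.
Unshelve. all: by end_near.
Qed.

Lemma site_threshold x (M : nat -> nat) (z : R) :
  (forall T n, (n < M T)%N = (n%:R < node_scale p T * z + p * T%:R)) ->
  forall u, u != z -> \forall T \near \oo,
    (site p T u < M T + x)%N = (u \in (`]-oo, z]%classic : set R)).
Proof.
move=> HM u uz; rewrite mem_setE in_itv /=.
case: (ltgtP u z) uz => // uz _; near=> T.
  have T0 : (0 < T)%N by near: T; exact: nbhs_infty_gt.
  have t0 : 0 < node_scale p T by exact: node_scale_gt0.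
  have h : 0 <= node_scale p T * u + p * T%:R by near: T; exact: near_site_ge0.
  apply: ltn_addr; rewrite HM.
  have /truncn_itv/andP[h1 _] := h; apply: (le_lt_trans h1).
  by rewrite ltrD2r ltr_pM2l.
have T0 : (0 < T)%N by near: T; exact: nbhs_infty_gt.
have t0 : 0 < node_scale p T by exact: node_scale_gt0.
have h : 0 <= node_scale p T * u + p * T%:R by near: T; exact: near_site_ge0.
have h' : 0 <= node_scale p T * (z - 1) + p * T%:R by near: T; exact: near_site_ge0.
(* The shift by [x] and the rounding in [M T] amount to at most [x + 1], which is negligible against
   the distance [node_scale p T * (u - z)]. *)
have h2 : (x.+1%:R) / (u - z) <= node_scale p T.
  by near: T; exact: near_node_scale_ge.
rewrite ler_pdivrMr ?subr_gt0 // in h2.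
apply/negbTE; rewrite -leqNgt.
have M0 : (0 < M T)%N by rewrite HM; move: h'; rewrite mulrBr; lra.
have M1 := HM T (M T).-1; rewrite prednK // leqnn in M1; move/esym: M1 => M1.
rewrite /site truncn_ge_nat // natrD -(prednK M0) -natr1.
by move: h2; rewrite -natr1 mulrBr; lra.
Unshelve. all: by end_near.
Qed.

Lemma cvg_moment_hankel n (N : nat -> nat) (D : set R) z : measurable D ->
  (forall u, u != z -> \forall T \near \oo, (site p T u < N T)%N = (u \in D)) ->
  \det (moment_hankel n T (N T)) @[T --> \oo] --> \det (gauss_hankel n D).
Proof.
move=> mD ND; apply: cvg_det => i j.
under eq_fun => T do rewrite mxE.
by rewrite mxE; exact: binomial_moment_cvg ND.
Qed.

End HankelLimit.

Unset Implicit Arguments.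
Set Strict Implicit.
Set Printing Implicit Defensive.

Theorem mainTheorem4 (R : realType) (d : measure_display)
    (T : measurableType d) (P : probability T R)
    (p : R) (hp0 : 0 < p) (hp1 : p < 1)
    (eps : nat * nat -> {RV P >-> bool}) (heps : iid_bernoulli p eps)
    (x : nat) (s : R) :
  P [set w |
      ((odb_height R (fun i => eps i w) t x - (p * t%:R)%:E)
         * ((Num.sqrt (p * (1 - p) * t%:R))^-1)%:E < s%:E)%E]
    @[t --> \oo] --> (F_GUE x.+1 s)%:E.
Proof.
pose z := s / Num.sqrt 2.
(* Heights from time [x] on are natural numbers, so the real threshold can be replaced by a natural
   one, to which the exact formula applies. *)
have /choice[M HM] : forall t : nat, exists M : nat, forall n,
    (n < M)%N = (n%:R < node_scale p t * z + p * t%:R).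
  by move=> t; exact: nat_threshold.
have [d0 ->] := F_GUE_hankel x.+1 s; rewrite -/z.
have cN := cvg_moment_hankel hp0 hp1 (n := x.+1) (measurable_itv _)
  (site_threshold hp0 hp1 x HM).
(* Truncation below [t.+1] keeps the whole binomial law, whence the full Gaussian moments; the
   exceptional point 0 is an arbitrary choice. *)
have cD := cvg_moment_hankel hp0 hp1 (n := x.+1) (z := 0) measurableT
  (fun u _ => site_full hp0 hp1 u).
pose r t := \det (moment_hankel p x.+1 t (M t + x)) /
  \det (moment_hankel p x.+1 t t.+1).
have c : (r t)%:E @[t --> \oo] -->
    (\det (gauss_hankel x.+1 `]-oo, z]) / \det (gauss_hankel x.+1 [set: R]))%:E.
  apply: cvg_EFin; first exact: nearW.
  by apply: cvgM => //; exact: cvgV.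
apply: cvg_trans c; apply: near_eq_cvg; rewrite /r; near=> t.
(* The exact formula is stated at times [t + x]; it is applied with [t - x]. *)
have xt : (x <= t)%N by near: t; exact: nbhs_infty_ge.
have t0 : (0 < t)%N by near: t; exact: nbhs_infty_gt.
have ns0 := node_scale_gt0 hp0 hp1 t0.
have q0 : 0 < 1 - p by rewrite subr_gt0.
have sg0 : 0 < Num.sqrt (p * (1 - p) * t%:R).
  by rewrite sqrtr_gt0 !mulr_gt0 ?ltr0n.
have nsE : node_scale p t = Num.sqrt 2 * Num.sqrt (p * (1 - p) * t%:R).
  by rewrite -sqrtrM //; congr Num.sqrt; ring.
have tE : t = (t - x + x)%N by rewrite subnK.
have := @odb_cdf_hankel R d T P p eps x (t - x) (p * t%:R) (node_scale p t)
  hp0 hp1 heps (lt0r_neq0 ns0) (M t).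
rewrite -tE /= !hankel_moment_hankel // => H.
transitivity (P [set w | (odb_height R (fun i => eps i w) t x < (M t)%:R%:E)%E]).
  rewrite H -mulf_div divff ?mul1r // expf_neq0 // mulf_neq0 ?gt_eqF //.
  by apply: binomial_weight_gt0 => //; exact: mode_le.
(* The [sqrt 2] in the cut-off of [F_GUE] cancels the one in [node_scale], which leaves the
   normalization of the theorem. *)
congr (P _); have zE : node_scale p t * z = s * Num.sqrt (p * (1 - p) * t%:R).
  by rewrite nsE /z; field; rewrite gt_eqF // sqrtr_gt0.
apply/funext => w; apply/propext => /=.
have -> : odb_height R (fun i => eps i w) t x =
    (lpp (fun i => eps i w) (t - x) x)%:R%:E by rewrite {1}tE odb_height_lpp.
rewrite lte_fin ltr_nat HM zE -EFinB -EFinM lte_fin ltr_pdivrMr //.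
by rewrite ltrBlDr.
Unshelve. all: by end_near.
Qed.
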